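(* Let $\mathcal F=\emptyset$, $\kappa=5$, and let $\gamma(H)=0$ for every graph $H$ of order 5 except $\gamma(P_3\cup K_2)=1$, where $P_3\cup K_2$ is the disjoint union of a path on 3 vertices and an edge. Let $B=K_3\cup K_3$ be the disjoint union of two triangles. Then the corresponding problem (the inducibility of $P_3\cup K_2$) is perfectly $B$-stable; moreover $\lim_{n\to\infty}\lambda(n,\mathcal G)=5/18$ and the unique maximiser of $\lambda(B(\mathbf a))$ over $\mathbf a\in\mathbb S_6$ is the vector with each entry $1/6$.
   Context: All graphs are finite and simple; ''subgraph'' means induced subgraph. $P(F,G)$ is the number of $v(F)$-subsets of $V(G)$ inducing a copy of $F$, $p(F,G)=P(F,G)/\binom{v(G)}{v(F)}$. Admissible graphs are those containing no member of $\mathcal F$ as induced subgraph (here all graphs); $\mathcal G$ is the class of admissible graphs. $\Lambda(G)=\sum_H\gamma(H)P(H,G)$ over isomorphism classes $H$ of order-$\kappa$ graphs, $\lambda(G)=\Lambda(G)/\binom{v(G)}\kappa$, $\lambda(n,\mathcal G)=\max\{\lambda(G):G\in\mathcal G,v(G)=n\}$. For a graph $B$ on $[m]$ and disjoint sets $V_1,\dots,V_m$, the blow-up $B(V_1,\dots,V_m)$ has vertex set $\bigcup V_i$, with $u\in V_i,w\in V_j$ adjacent iff $ij\in E(B)$; $B()$ is the family of all blow-ups. $\mathbb S_m$ is the simplex of probability vectors in $\mathbb R^m$; $\lambda(B(\mathbf a))=\lim_{n}\lambda(B(V_{1,n},\dots,V_{m,n}))$ with $|V_{i,n}|=a_in+O(1)$.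 $\delta_{\mathrm{edit}}(G,B())$ is the minimal number of adjacency changes turning $G$ (order $n$) into a blow-up of $B$, divided by $\binom n2$. Perfectly $B$-stable: there is $C>0$ with $\delta_{\mathrm{edit}}(G,B())\le C(\lambda(n,\mathcal G)-\lambda(G))$ for all admissible $G$ of order $n\ge C$. *)

(* Defs.v *)
From HB Require Import structures.
From mathcomp Require Import all_boot all_order all_algebra.
From mathcomp Require Import boolp classical_sets reals topology normedtype.
From mathcomp Require Import sequences.

Set Implicit Arguments.
Unset Strict Implicit.
Unset Printing Implicit Defensive.

Import Order.TTheory GRing.Theory Num.Theory.
Import numFieldNormedType.Exports.

Local Open Scope ring_scope.

(** * Finite simple graphs *)

Definition simple_adj (T : finType) (e : {ffun T * T -> bool}) : bool :=
  [forall x, ~~ e (x, x)] && [forall x, forall y, e (x, y) == e (y, x)].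

Record sgraph (T : finType) : Type :=
  SGraph { adj_fun : {ffun T * T -> bool}; _ : simple_adj adj_fun }.

HB.instance Definition _ (T : finType) := [isSub for @adj_fun T].
HB.instance Definition _ (T : finType) := [Countable of sgraph T by <:].
HB.instance Definition _ (T : finType) := [Finite of sgraph T by <:].

Definition adj (T : finType) (G : sgraph T) : rel T :=
  fun x y => adj_fun G (x, y).

Lemma simple_adj_rel (T : finType) (r : rel T) :
  irreflexive r -> symmetric r -> simple_adj [ffun p => r p.1 p.2].
Proof.
move=> r_irr r_sym; apply/andP; split.
  by apply/forallP => x; rewrite ffunE r_irr.
by apply/forallP => x; apply/forallP => y; rewrite !ffunE /= r_sym.
Qed.

Definition sgraph_of (T : finType) (r : rel T)
    (r_irr : irreflexive r) (r_sym : symmetric r) : sgraph T :=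
  SGraph (simple_adj_rel r_irr r_sym).

Lemma adj_irr (T : finType) (G : sgraph T) : irreflexive (adj G).
Proof.
by case: G => e e_simple x; case/andP: (e_simple) => /forallP/(_ x)/negbTE.
Qed.

Lemma adj_sym (T : finType) (G : sgraph T) : symmetric (adj G).
Proof.
case: G => e e_simple x y.
by case/andP: (e_simple) => _ /forallP/(_ x)/forallP/(_ y)/eqP.
Qed.

Lemma adj_sgraph_of (T : finType) (r : rel T) (ri : irreflexive r)
  (rs : symmetric r) x y : adj (sgraph_of ri rs) x y = r x y.
Proof. by rewrite /adj ffunE. Qed.

Definition edges (T : finType) (G : sgraph T) : {set {set T}} :=
  [set [set p.1; p.2] | p : T * T & adj G p.1 p.2].

Definition isomorphic (T U : finType) (G : sgraph T) (H : sgraph U) : bool :=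
  [exists f : {ffun T -> U}, [&& injectiveb f, f @: [set: T] == [set: U]
    & [forall x, forall y, adj H (f x) (f y) == adj G x y]]].

(** ** Concrete graphs; a graph of order [n] has vertex set ['I_n]. *)

Definition complete_rel n : rel 'I_n := fun x y => x != y.

Lemma complete_irr n : irreflexive (@complete_rel n).
Proof. by move=> x; rewrite /complete_rel eqxx. Qed.

Lemma complete_sym n : symmetric (@complete_rel n).
Proof. by move=> x y; rewrite /complete_rel eq_sym. Qed.

Definition complete_graph n : sgraph 'I_n :=
  sgraph_of (@complete_irr n) (@complete_sym n).

Definition path_rel n : rel 'I_n :=
  fun x y => (x.+1 == y :> nat) || (y.+1 == x :> nat).

Lemma path_irr n : irreflexive (@path_rel n).
Proof. by move=> x; rewrite /path_rel orbb gtn_eqF. Qed.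

Lemma path_sym n : symmetric (@path_rel n).
Proof. by move=> x y; rewrite /path_rel orbC. Qed.

(** [n] is the number of vertices. *)
Definition path_graph n : sgraph 'I_n := sgraph_of (@path_irr n) (@path_sym n).

Definition dunion_rel m n (G : sgraph 'I_m) (H : sgraph 'I_n) :
    rel 'I_(m + n) :=
  fun x y => match fintype.split x, fintype.split y with
             | inl i, inl j => adj G i j
             | inr i, inr j => adj H i j
             | _, _ => false
             end.

Lemma dunion_irr m n (G : sgraph 'I_m) (H : sgraph 'I_n) :
  irreflexive (dunion_rel G H).
Proof.
by move=> x; rewrite /dunion_rel; case: fintype.split => i; apply: adj_irr.
Qed.

Lemma dunion_sym m n (G : sgraph 'I_m) (H : sgraph 'I_n) :
  symmetric (dunion_rel G H).
Proof.
move=> x y; rewrite /dunion_rel.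
by case: fintype.split => i; case: fintype.split => j //; apply: adj_sym.
Qed.

Definition dunion m n (G : sgraph 'I_m) (H : sgraph 'I_n) : sgraph 'I_(m + n) :=
  sgraph_of (dunion_irr G H) (dunion_sym G H).

(** ** Blow-ups

    The parts are [V_i = f @^-1: [set i]], so they are disjoint, cover [T]
    and may be empty. *)

Definition blowup_rel (T : finType) m (B : sgraph 'I_m) (f : T -> 'I_m) :
    rel T :=
  fun x y => adj B (f x) (f y).

Lemma blowup_irr (T : finType) m (B : sgraph 'I_m) (f : T -> 'I_m) :
  irreflexive (blowup_rel B f).
Proof. by move=> x; apply: adj_irr. Qed.

Lemma blowup_sym (T : finType) m (B : sgraph 'I_m) (f : T -> 'I_m) :
  symmetric (blowup_rel B f).
Proof. by move=> x y; apply: adj_sym. Qed.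

Definition blowup (T : finType) m (B : sgraph 'I_m) (f : T -> 'I_m) :
    sgraph T :=
  sgraph_of (blowup_irr B f) (blowup_sym B f).

Definition blowup_sizes m (B : sgraph 'I_m) (s : 'I_m -> nat) :
    sgraph {i : 'I_m & 'I_(s i)} :=
  blowup B (@tag 'I_m (fun i => 'I_(s i))).

(** * Induced subgraph counts and the extremal problem *)

Definition induced_count (U T : finType) (F : sgraph U) (G : sgraph T) : nat :=
  #|[set S : {set T} | [exists f : {ffun U -> T},
      [&& injectiveb f, f @: [set: U] == S
        & [forall x, forall y, adj G (f x) (f y) == adj F x y]]]]|.

(** One graph from each isomorphism class of graphs of order [k]. *)
Definition iso_reps k : {set sgraph 'I_k} :=
  transversal
    (equivalence_partition (@isomorphic 'I_k 'I_k) [set: sgraph 'I_k])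
    [set: sgraph 'I_k].

(** A forbidden family: for every order, a set of graphs of that order. *)
Definition gfamily := forall k : nat, set (sgraph 'I_k).

Definition admissible (F : gfamily) (T : finType) (G : sgraph T) : Prop :=
  forall k (H : sgraph 'I_k), F k H -> induced_count H G = 0%N.

Section Problem.
Variables (R : realType) (F : gfamily) (k : nat) (gamma : sgraph 'I_k -> R).

Definition Lambda (T : finType) (G : sgraph T) : R :=
  \sum_(H in iso_reps k) gamma H * (induced_count H G)%:R.

Definition lambda (T : finType) (G : sgraph T) : R :=
  Lambda G / 'C(#|T|, k)%:R.

(** There are finitely many graphs on ['I_n], so this supremum is a maximum
    as soon as some graph on ['I_n] is admissible. *)
Definition lambda_max (n : nat) : R :=
  sup [set lambda G | G in [set G : sgraph 'I_n | admissible F G]]%classic.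

Section BlowUps.
Variables (m : nat) (B : sgraph 'I_m).

(** A pair of vertices is never changed twice, so the default value ['C(n, 2)]
    of the minimum bounds all its terms. *)
Definition edit_dist (T : finType) (G : sgraph T) : R :=
  (\big[Order.min/'C(#|T|, 2)]_(f : {ffun T -> 'I_m})
      #|(edges G :\: edges (blowup B f)) :|: (edges (blowup B f) :\: edges G)|
  )%:R / 'C(#|T|, 2)%:R.

Definition perfectly_stable : Prop :=
  exists2 C : R, 0 < C &
    forall n (G : sgraph 'I_n), C <= n%:R -> admissible F G ->
      edit_dist G <= C * (lambda_max n - lambda G).

Definition simplex (a : 'rV[R]_m) : Prop :=
  (forall i, 0 <= a 0 i) /\ \sum_i a 0 i = 1.

(** [l] is the limit of [lambda (B(V_1n, ..., V_mn))] whenever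
    [|V_in| = a_i n + O(1)]. *)
Definition is_blowup_lambda (a : 'rV[R]_m) (l : R) : Prop :=
  forall s : nat -> 'I_m -> nat,
    (exists K : R, forall n i, `|(s n i)%:R - a 0 i * n%:R| <= K) ->
    (lambda (blowup_sizes B (s n)) @[n --> \oo] --> l)%classic.

(** The value [0] is used only if no such limit exists. *)
Definition blowup_lambda (a : 'rV[R]_m) : R :=
  xget 0 [set l | is_blowup_lambda a l]%classic.

Definition blowup_maximiser (a : 'rV[R]_m) : Prop :=
  simplex a /\ forall b, simplex b -> blowup_lambda b <= blowup_lambda a.

End BlowUps.
End Problem.

(** * The inducibility problem for the disjoint union of [P_3] and [K_2] *)

Definition no_forbidden : gfamily := fun k => set0.

Definition P3K2 : sgraph 'I_5 := dunion (path_graph 3) (complete_graph 2).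

Definition K3K3 : sgraph 'I_6 := dunion (complete_graph 3) (complete_graph 3).

Definition gammaP3K2 (R : realType) (H : sgraph 'I_5) : R :=
  (isomorphic H P3K2)%:R.

(* Main.v *)
Require Import Defs.
From Stdlib Require Import ZArith.
From mathcomp Require Import all_boot all_order all_algebra.
From mathcomp Require Import reals.
From mathcomp Require Import zify ssrZ ring lra.

(** Counting 5-tuples with repetitions allowed makes the flag algebra bound
    exact, and it then holds for weighted vertices too: if the weights add up to
    [m], then [m^5 - 108 h >= bad / 75], where [h] is the weight of the 5-tuples
    inducing a fixed labelling of P_3 + K_2 and [bad] that of the 5-tuples inducing
    a graph which does not embed in a blow-up of K_3 + K_3. Up to three sums of
    squares, this holds for each of the 1024 labelled graphs of order 5.

    An induced 2K_2 in [G] assigns every vertex to one of six parts, and a pair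
    whose adjacency disagrees with this partition yields a bad 5-tuple. Averaging
    over all induced 2K_2 bounds the number [W] of wrong pairs of the best
    partition by a multiple of [bad / n^3].

    If [G] is nearly optimal, the parts have nearly [n / 6] vertices. Weights
    close to 1 make the partition exactly balanced, so that its blow-up attains
    the bound; as [G] and the blow-up differ on O(W n^3) tuples only, the weighted
    inequality implies that without weights too the blow-up has at least
    [c W n^3] more copies than [G]. No error term independent of [W] remains,
    which gives perfect stability. *)

Set Implicit Arguments.
Unset Strict Implicit.
Unset Printing Implicit Defensive.
Import Order.TTheory GRing.Theory Num.Theory.

(** ** The certificate on labelled graphs of order 5 *)

Definition degrees (g : rel nat) (S : seq nat) : seq nat :=
  sort leq [seq count (g i) S | i <- S].

(* The graph that [g] induces on [S] does not embed in a blow-up of K_3 + K_3: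
   it contains P_4, K_4 or a triangle with a pendant edge (which their degree
   sequences determine), or it is 2K_2 + K_1. *)
Definition bad (g : rel nat) (S : seq nat) : bool :=
  has (fun i => degrees g (rem i S) \in
         [:: [:: 1; 1; 2; 2]; [:: 1; 2; 2; 3]; [:: 3; 3; 3; 3]]) S
  || (degrees g S == [:: 0; 1; 1; 1; 1]).

Section Integer.
Local Open Scope Z_scope.

Fixpoint dot (s t : seq Z) : Z :=
  match s, t with
  | a :: s', b :: t' => a * b + dot s' t'
  | _, _ => 0
  end.

Definition bilin (Q : seq (seq Z)) (s t : seq Z) : Z :=
  dot s [seq dot r t | r <- Q].

(* Rational solution of the flag algebra semidefinite program, in the coordinates
   [flag1], [flag2] and [flag3] of the flags. *)
Definition Q1 : seq (seq Z) :=
  [:: [:: 5760; -1056; -12702; -4329];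
      [:: -1056; 1368; 1698; -1977];
      [:: -12702; 1698; 46116; 3039];
      [:: -4329; -1977; 3039; 13824]].

Definition Q2 : seq (seq Z) :=
  [:: [:: 21760; 3784; -23952];
      [:: 3784; 1728; -5184];
      [:: -23952; -5184; 31104]].

Definition Q3 : seq (seq Z) := [:: [:: 1728; -1728]; [:: -1728; 3456]].

(* Coordinates of a flag, orthogonal to the flag densities of the balanced
   blow-up. The type is a vertex [r], the flag is (r, u, v), and [a], [b], [c]
   tell whether ru, rv, uv are edges. *)
Definition flag1 (a b c : bool) : seq Z :=
  match a, b, c with
  | false, false, false => [:: 1; 0; 0; 0]
  | true, false, false | false, true, false => [:: 0; 1; 0; 0]
  | true, true, false => [:: 0; 0; 1; 0]
  | false, false, true => [:: 0; 0; 0; 0]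
  | true, false, true | false, true, true => [:: 0; 0; 0; 1]
  | true, true, true => [:: -5; -6; -1; -2]
  end.

(* In [flag2] the type (x, y, z) has the only edge yz, in [flag3] it is a path
   with middle vertex z; the flag has one more vertex, and [a], [b], [c] tell
   whether it is adjacent to x, y, z. *)
Definition flag2 (a b c : bool) : seq Z :=
  match a, b, c with
  | false, false, false => [:: -2; -2; -1]
  | true, false, false => [:: 3; 0; 0]
  | false, true, false | false, false, true => [:: -2; 1; 0]
  | false, true, true => [:: 0; 0; 1]
  | _, _, _ => [:: 0; 0; 0]
  end.

Definition flag3 (a b c : bool) : seq Z :=
  match a, b, c with
  | false, false, false => [:: -1; -1]
  | true, true, false => [:: 3; 0]
  | true, true, true => [:: 0; 3]
  | _, _, _ => [:: 0; 0]
  end.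

End Integer.

Definition vtx (p : seq nat) (i : nat) : nat := nth 0 p i.

Definition sq1 (g : rel nat) (p : seq nat) : Z :=
  let v := vtx p in
  bilin Q1 (flag1 (g (v 0) (v 1)) (g (v 0) (v 2)) (g (v 1) (v 2)))
           (flag1 (g (v 0) (v 3)) (g (v 0) (v 4)) (g (v 3) (v 4))).

Definition sq2 (g : rel nat) (p : seq nat) : Z :=
  let v := vtx p in
  if [&& ~~ g (v 0) (v 1), ~~ g (v 0) (v 2) & g (v 1) (v 2)] then
    bilin Q2 (flag2 (g (v 0) (v 3)) (g (v 1) (v 3)) (g (v 2) (v 3)))
             (flag2 (g (v 0) (v 4)) (g (v 1) (v 4)) (g (v 2) (v 4)))
  else Z0.

Definition sq3 (g : rel nat) (p : seq nat) : Z :=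
  let v := vtx p in
  if [&& ~~ g (v 0) (v 1), g (v 0) (v 2) & g (v 1) (v 2)] then
    bilin Q3 (flag3 (g (v 0) (v 3)) (g (v 1) (v 3)) (g (v 2) (v 3)))
             (flag3 (g (v 0) (v 4)) (g (v 1) (v 4)) (g (v 2) (v 4)))
  else Z0.

Definition isP3K2 (g : rel nat) (p : seq nat) : bool :=
  let v := vtx p in
  [&& g (v 0) (v 1), g (v 1) (v 2), ~~ g (v 0) (v 2), g (v 3) (v 4),
      ~~ g (v 0) (v 3), ~~ g (v 0) (v 4), ~~ g (v 1) (v 3), ~~ g (v 1) (v 4),
      ~~ g (v 2) (v 3) & ~~ g (v 2) (v 4)].

Definition perms5 : seq (seq nat) := permutations (iota 0 5).

(* One ordering from each class under the symmetries of [sq1], [sq2], [sq3] and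
   of P_3 + K_2. *)
Definition orders1 : seq (seq nat) :=
  [seq p <- perms5 | [&& vtx p 1 < vtx p 2, vtx p 3 < vtx p 4 & vtx p 1 < vtx p 3]].
Definition orders2 : seq (seq nat) :=
  [seq p <- perms5 | [&& vtx p 1 < vtx p 2 & vtx p 3 < vtx p 4]].
Definition orders3 : seq (seq nat) :=
  [seq p <- perms5 | [&& vtx p 0 < vtx p 1 & vtx p 3 < vtx p 4]].
Definition orders4 : seq (seq nat) :=
  [seq p <- perms5 | [&& vtx p 0 < vtx p 2 & vtx p 3 < vtx p 4]].

Section Integer2.
Local Open Scope Z_scope.

Definition zsum (F : seq nat -> Z) (L : seq (seq nat)) : Z :=
  foldr (fun p z => F p + z) 0 L.

(* The linear form of a labelled graph whose sum over the 5-tuples of a graph of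
   order n is [2304 * 75 * (n^5 - 108 h)] minus three nonnegative sums. *)
Definition slack_on (L1 L2 L3 L4 : seq (seq nat)) (g : rel nat) : Z :=
  2304 * (75 - 270 * zsum (fun p => if isP3K2 g p then 1 else 0) L4)
  - 2 * zsum (sq1 g) L1 - zsum (sq2 g) L2 - zsum (sq3 g) L3.

Definition slack : rel nat -> Z := slack_on orders1 orders2 orders3 orders4.

Definition table (rows : seq (seq bool)) : rel nat :=
  fun i j => nth false (nth [::] rows i) j.

Definition allb (P : bool -> bool) : bool := P true && P false.

Lemma allbP (P : bool -> bool) : allb P -> forall b, P b.
Proof. by case/andP => Pt Pf []. Qed.

Definition table5 (a b c d e f h i j k : bool) : rel nat :=
  table [:: [:: false; a; b; c; d]; [:: a; false; e; f; h];
            [:: b; e; false; i; j]; [:: c; f; i; false; k];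
            [:: d; h; j; k; false]].

Definition slack_check : bool :=
  let L1 := orders1 in let L2 := orders2 in
  let L3 := orders3 in let L4 := orders4 in
  allb (fun a => allb (fun b => allb (fun c => allb (fun d => allb (fun e =>
  allb (fun f => allb (fun h => allb (fun i => allb (fun j => allb (fun k =>
    let g := table5 a b c d e f h i j k in
    (if bad g (iota 0 5) then 2304 else 0) <=? slack_on L1 L2 L3 L4 g)))))))))).

Lemma slack_checkP : slack_check.
Proof. by vm_compute. Qed.

End Integer2.

(* MathComp rebinds the key [Z] to the scope of its type [int]. *)
Delimit Scope Z_scope with ZZ.

Definition agree (n : nat) (g h : rel nat) : Prop :=
  forall i j, i < n -> j < n -> g i j = h i j.

Lemma bad_agree n (g h : rel nat) (S : seq nat) :
  agree n g h -> all (ltn^~ n) S -> bad g S = bad h S.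
Proof.
move=> gh /allP Sn.
have deg_eq S' : {subset S' <= S} -> degrees g S' = degrees h S'.
  move=> sub; congr sort; apply/eq_in_map => i /sub/Sn i_lt.
  by apply: eq_in_count => j /sub/Sn j_lt; apply: gh.
rewrite /bad (deg_eq S) //; congr orb.
by apply: eq_in_has => i _; rewrite deg_eq // => j /mem_rem.
Qed.

Lemma zsum_eq (F H : seq nat -> Z) (L : seq (seq nat)) :
  {in L, F =1 H} -> zsum F L = zsum H L.
Proof.
elim: L => //= p L IH FH; rewrite FH ?mem_head // IH // => q qL.
by apply: FH; rewrite inE qL orbT.
Qed.

Lemma vtx_lt p i : p \in perms5 -> vtx p i < 5.
Proof.
rewrite mem_permutations => p_perm; rewrite /vtx.
have [i_lt|i_ge] := ltnP i (size p); last by rewrite nth_default.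
have := mem_nth 0 i_lt; by rewrite (perm_mem p_perm) mem_iota => /andP[].
Qed.

Lemma slack_agree (g h : rel nat) : agree 5 g h -> slack g = slack h.
Proof.
move=> gh; rewrite /slack /slack_on.
have sub (a : pred (seq nat)) p : p \in [seq q <- perms5 | a q] -> p \in perms5.
  by rewrite mem_filter => /andP[].
congr (_ * (_ - _ * _) - _ * _ - _ - _)%ZZ; apply: zsum_eq => p /sub pP;
  by rewrite /isP3K2 /sq1 /sq2 /sq3; cbv zeta; rewrite !gh ?vtx_lt.
Qed.

Definition simple_rel (g : rel nat) : Prop := irreflexive g /\ symmetric g.

Lemma slack_ge (g : rel nat) : simple_rel g ->
  ((if bad g (iota 0 5) then 2304 else 0) <= slack g)%ZZ.
Proof.
move=> [g_irr g_sym].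
pose h := table5 (g 0 1) (g 0 2) (g 0 3) (g 0 4) (g 1 2) (g 1 3) (g 1 4)
                 (g 2 3) (g 2 4) (g 3 4).
have gh : agree 5 g h.
  do 5?[case=> [|]]; move=> // j _; do 5?[case: j => [|j]] => // _;
    by rewrite ?g_irr // g_sym.
rewrite (bad_agree gh) // (slack_agree gh); apply/Z.leb_le.
move: slack_checkP; rewrite /slack_check; cbv zeta.
move/allbP/(_ (g 0 1)); move/allbP/(_ (g 0 2));
move/allbP/(_ (g 0 3)); move/allbP/(_ (g 0 4));
move/allbP/(_ (g 1 2)); move/allbP/(_ (g 1 3));
move/allbP/(_ (g 1 4)); move/allbP/(_ (g 2 3));
move/allbP/(_ (g 2 4)); move/allbP/(_ (g 3 4)).
exact.
Qed.

Definition place (xa xb xd xe : bool) : nat :=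
  match xa, xb, xd, xe with
  | false, true, _, _ => 0
  | true, false, _, _ => 1
  | true, true, _, _ => 2
  | false, false, false, true => 3
  | false, false, true, false => 4
  | false, false, true, true => 5
  | false, false, false, false => 0
  end.

Lemma place_lt xa xb xd xe : place xa xb xd xe < 6.
Proof. by case: xa xb xd xe => [] [] [] []. Qed.

Definition k3k3 (i j : nat) : bool := (i != j) && ((i < 3) == (j < 3)).

Definition table6 (xa xb xd xe ya yb yd ye xy : bool) : rel nat :=
  table [:: [:: false; true; false; false; xa; ya];
            [:: true; false; false; false; xb; yb];
            [:: false; false; false; true; xd; yd];
            [:: false; false; true; false; xe; ye];
            [:: xa; xb; xd; xe; false; xy];
            [:: ya; yb; yd; ye; xy; false]].

Definition place_check : bool :=
  allb (fun xa => allb (fun xb => allb (fun xd => allb (fun xe =>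
  allb (fun ya => allb (fun yb => allb (fun yd => allb (fun ye =>
  allb (fun xy =>
    let g := table6 xa xb xd xe ya yb yd ye xy in
    has (fun i => bad g (rem i (iota 0 6))) (iota 0 6)
    || (xy == k3k3 (place xa xb xd xe) (place ya yb yd ye))))))))))).

Lemma place_checkP : place_check.
Proof. by vm_compute. Qed.

Lemma ltn6_cases (P : nat -> Prop) :
  P 0 -> P 1 -> P 2 -> P 3 -> P 4 -> P 5 -> forall i, i < 6 -> P i.
Proof. by move=> ? ? ? ? ? ?; do 6?[case=> //]. Qed.

Definition is2K2 (g : rel nat) : bool :=
  [&& g 0 1, g 2 3, ~~ g 0 2, ~~ g 0 3, ~~ g 1 2 & ~~ g 1 3].

(* The four vertices of an induced 2K_2 lie in four different parts of the
   blow-up, so they tell every other vertex its part. *)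
Lemma place_adj (g : rel nat) : simple_rel g -> is2K2 g ->
  ~~ has (fun i => bad g (rem i (iota 0 6))) (iota 0 6) ->
  g 4 5 = k3k3 (place (g 0 4) (g 1 4) (g 2 4) (g 3 4))
               (place (g 0 5) (g 1 5) (g 2 5) (g 3 5)).
Proof.
move=> [g_irr g_sym] /and5P[g01 g23 g02 g03 /andP[g12 g13]].
pose h := table6 (g 0 4) (g 1 4) (g 2 4) (g 3 4)
                 (g 0 5) (g 1 5) (g 2 5) (g 3 5) (g 4 5).
have gh : agree 6 g h.
  move=> i j i_lt j_lt; move: i i_lt; apply: ltn6_cases; move: j j_lt;
    apply: ltn6_cases; rewrite /h /table6 /table /= ?g_irr //;
    first [exact/negbTE | by rewrite g_sym | by rewrite g_sym; exact/negbTE].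
have -> : has (fun i => bad g (rem i (iota 0 6))) (iota 0 6) =
          has (fun i => bad h (rem i (iota 0 6))) (iota 0 6).
  apply: eq_has => i; apply: (bad_agree gh).
  by apply/allP => j /mem_rem; rewrite mem_iota.
move=> /negbTE bad_h; move: place_checkP; rewrite /place_check; cbv zeta.
move/allbP/(_ (g 0 4)); move/allbP/(_ (g 1 4)); move/allbP/(_ (g 2 4)).
move/allbP/(_ (g 3 4)); move/allbP/(_ (g 0 5)); move/allbP/(_ (g 1 5)).
move/allbP/(_ (g 2 5)); move/allbP/(_ (g 3 5)); move/allbP/(_ (g 4 5)).
by rewrite -/h bad_h => /eqP.
Qed.

Local Open Scope ring_scope.

(** ** Weighted sums over 5-tuples *)

Section Tuples.
Variables (T : finType).

Definition tup5 (a b c d f : T) : {ffun 'I_5 -> T} :=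
  [ffun i : 'I_5 => nth a [:: a; b; c; d; f] i].

Lemma big_tup5 (R : nmodType) (F : {ffun 'I_5 -> T} -> R) :
  \sum_x F x = \sum_a \sum_b \sum_c \sum_d \sum_f F (tup5 a b c d f).
Proof.
rewrite (reindex (fun t : T * (T * (T * (T * T))) =>
  tup5 t.1 t.2.1 t.2.2.1 t.2.2.2.1 t.2.2.2.2)) /=; last first.
  exists (fun x => (x (inord 0), (x (inord 1),
                    (x (inord 2), (x (inord 3), x (inord 4)))))).
    by move=> [a [b [c [d f]]]] _; rewrite /= !ffunE !inordK.
  move=> x _; apply/ffunP => i; rewrite ffunE /=.
  case: i => [] [|[|[|[|[|//]]]]] i_lt /=; congr (x _); apply/val_inj;
    by rewrite /= inordK.
rewrite -(pair_bigA _ (fun a t => F (tup5 a t.1 t.2.1 t.2.2.1 t.2.2.2))) /=.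
apply: eq_bigr => a _.
rewrite -(pair_bigA _ (fun b t => F (tup5 a b t.1 t.2.1 t.2.2))) /=.
apply: eq_bigr => b _.
rewrite -(pair_bigA _ (fun c t => F (tup5 a b c t.1 t.2))) /=.
apply: eq_bigr => c _.
by rewrite -(pair_bigA _ (fun d f => F (tup5 a b c d f))).
Qed.

Definition pattern (e : rel T) (x : nat -> T) : rel nat :=
  fun i j => e (x i) (x j).

Definition at5 (x : {ffun 'I_5 -> T}) (i : nat) : T := x (inord i).

Lemma pattern_simple (e : rel T) (x : nat -> T) :
  irreflexive e -> symmetric e -> simple_rel (pattern e x).
Proof. by move=> ei es; split=> [i|i j]; rewrite /pattern. Qed.

Lemma pattern_tup5 e a b c d f :
  agree 5 (pattern e (at5 (tup5 a b c d f))) (pattern e (nth a [:: a; b; c; d; f])).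
Proof. by move=> i j ? ?; rewrite /pattern /at5 !ffunE !inordK. Qed.

Section Weights.
Variables (R : comNzRingType) (mu : T -> R).

Definition weight (x : {ffun 'I_5 -> T}) : R := \prod_i mu (x i).

Lemma weight_tup5 a b c d f :
  weight (tup5 a b c d f) = mu a * mu b * mu c * mu d * mu f.
Proof. by rewrite /weight !big_ord_recl big_ord0 !ffunE /= mulr1 !mulrA. Qed.

Definition wcount (e : rel T) (P : rel nat -> R) : R :=
  \sum_x weight x * P (pattern e (at5 x)).

Lemma eq_wcount e (P P' : rel nat -> R) : P =1 P' -> wcount e P = wcount e P'.
Proof. by move=> PP'; apply: eq_bigr => x _; rewrite PP'. Qed.

Lemma wcount_tup5 e (P : rel nat -> R) :
  (forall g h, agree 5 g h -> P g = P h) ->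
  wcount e P = \sum_a mu a * \sum_b mu b * \sum_c mu c * \sum_d mu d *
    \sum_f mu f * P (pattern e (nth a [:: a; b; c; d; f])).
Proof.
move=> Pext; rewrite /wcount big_tup5; apply: eq_bigr => a _.
do 4!(rewrite ?mulrA mulr_sumr; apply: eq_bigr => ? _).
by rewrite weight_tup5 (Pext _ _ (pattern_tup5 e _ _ _ _ _)) !mulrA.
Qed.

Lemma wcount_perm e (P : rel nat -> R) p :
  (forall g h, agree 5 g h -> P g = P h) -> p \in perms5 ->
  wcount e (fun g => P (relpre (vtx p) g)) = wcount e P.
Proof.
move=> Pext p5; pose s (i : 'I_5) : 'I_5 := inord (vtx p i).
have s_inj : injective s.
  move=> i j /(congr1 val); rewrite /= !inordK ?vtx_lt // => /eqP.
  have /andP[/eqP sz un] : (size p == 5) && uniq p.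
    by move: p5; rewrite mem_permutations => pp; rewrite (perm_size pp) (perm_uniq pp).
  by rewrite nth_uniq ?sz // => /eqP/val_inj.
rewrite {2}/wcount (reindex (fun x : {ffun 'I_5 -> T} =>
  [ffun i => x (s i)])) /=; last first.
  exists (fun x => [ffun i => x (invF s_inj i)]) => x _; apply/ffunP => i;
    by rewrite !ffunE ?f_invF ?invF_f.
apply: eq_bigr => x _; congr (_ * _).
  rewrite /weight (reindex s) /=; last by apply: onW_bij; apply: injF_bij.
  by apply: eq_bigr => i _; rewrite ffunE.
apply: Pext => i j i5 j5.
by rewrite /pattern /at5 /= !ffunE /s !inordK.
Qed.
End Weights.
End Tuples.

(** ** The weighted inequality *)

Section FlagInequality.
Variable R : realFieldType.

Definition zr (z : Z) : R := (int_of_Z z)%:~R.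

Lemma zrD (a b : Z) : zr (a + b)%ZZ = zr a + zr b.
Proof. by rewrite /zr (rmorphD int_of_Z) rmorphD. Qed.

Lemma zrM (a b : Z) : zr (a * b)%ZZ = zr a * zr b.
Proof. by rewrite /zr (rmorphM int_of_Z) rmorphM. Qed.

Lemma zrB (a b : Z) : zr (a - b)%ZZ = zr a - zr b.
Proof. by rewrite /zr (rmorphB int_of_Z) rmorphB. Qed.

Lemma zr0 : zr Z0 = 0. Proof. by []. Qed.

Lemma zr1 : zr (Zpos xH) = 1. Proof. by []. Qed.

Lemma zr_xO p : zr (Zpos (xO p)) = 2 * zr (Zpos p).
Proof. by rewrite -[Zpos (xO p)]/(Z.mul (Zpos (xO xH)) (Zpos p)) zrM. Qed.

Lemma zr_xI p : zr (Zpos (xI p)) = 2 * zr (Zpos p) + 1.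
Proof.
by rewrite -[Zpos (xI p)]/(Z.add (Z.mul (Zpos (xO xH)) (Zpos p)) (Zpos xH)) zrD zrM.
Qed.

Lemma zr_neg p : zr (Zneg p) = - zr (Zpos p).
Proof. by rewrite -[Zneg p]/(Z.sub Z0 (Zpos p)) zrB sub0r. Qed.

Definition zrE := (zr0, zr1, zr_xO, zr_xI, zr_neg).

Lemma ler_zr (a b : Z) : (a <= b)%ZZ -> zr a <= zr b.
Proof. by move=> ab; rewrite /zr ler_int; lia. Qed.

Definition psd (k : nat) (Q : seq (seq Z)) : Prop :=
  forall y : nat -> R,
    0 <= \sum_(i < k) y i * \sum_(j < k) zr (nth Z0 (nth [::] Q i) j) * y j.

Lemma zr_dot k (s t : seq Z) : size s = k -> size t = k ->
  zr (dot s t) = \sum_(i < k) zr (nth Z0 s i) * zr (nth Z0 t i).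
Proof.
elim: k s t => [|k IH] [|a s] [|b t] //=; first by rewrite big_ord0.
by move=> [sk] [tk]; rewrite zrD zrM big_ord_recl /= (IH s t).
Qed.

Lemma bilin_sum_ge0 (X : finType) (nu : X -> R) (y : X -> seq Z) k Q :
  (forall p, size (y p) = k) -> size Q = k -> all (fun r => size r == k) Q ->
  psd k Q ->
  0 <= \sum_p nu p * \sum_q nu q * zr (bilin Q (y p) (y q)).
Proof.
move=> yk Qk /allP Qrow Qpsd.
pose Y i := \sum_p nu p * zr (nth Z0 (y p) i).
have := Qpsd Y; congr (0 <= _).
under [RHS]eq_bigr => p _.
  under eq_bigr => q _.
    rewrite (zr_dot (yk p)) ?size_map // mulr_sumr.
    under eq_bigr => i _.
      rewrite (nth_map [::]) ?Qk // (zr_dot _ (yk q)); last first.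
        by apply/eqP/Qrow/mem_nth; rewrite Qk.
      over.
    over.
  rewrite exchange_big mulr_sumr.
  over.
rewrite exchange_big; apply: eq_bigr => i _ /=.
rewrite /Y mulr_suml; apply: eq_bigr => p _; rewrite -mulrA; congr (_ * _).
rewrite mulr_sumr.
under [LHS]eq_bigr => j _ do rewrite 2!mulr_sumr.
rewrite exchange_big; apply: eq_bigr => q _ /=.
by rewrite !mulr_sumr; apply: eq_bigr => j _; ring.
Qed.

Lemma psd1 : psd 4 Q1.
Proof.
move=> y; rewrite !big_ord_recl !big_ord0 /= !zrE.
set a := y _; set b := y _; set c := y _; set d := y _.
(* Squares near those of the Cholesky decomposition, with small coefficients. *)
have := sqr_ge0 (a - 11 / 60 * b - 2117 / 960 * c - 481 / 640 * d).
have := sqr_ge0 (b - 1 / 2 * c - 9 / 4 * d).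
have := sqr_ge0 (b - 1 / 2 * c - 5 / 2 * d).
have := sqr_ge0 (b - 3 / 5 * c - 12 / 5 * d).
have := sqr_ge0 (c - 1 / 2 * d); have := sqr_ge0 (c - 2 / 5 * d).
have := sqr_ge0 d; have := sqr_ge0 c.
lra.
Qed.

Lemma psd2 : psd 3 Q2.
Proof.
move=> y; rewrite !big_ord_recl !big_ord0 /= !zrE.
set a := y _; set b := y _; set c := y _.
have := sqr_ge0 (a + 473 / 2720 * b - 1497 / 1360 * c).
have := sqr_ge0 (b - c); have := sqr_ge0 (b - 9 / 10 * c); have := sqr_ge0 c.
lra.
Qed.

Lemma psd3 : psd 2 Q3.
Proof.
move=> y; rewrite !big_ord_recl !big_ord0 /= !zrE.
set a := y _; set b := y _.
have := sqr_ge0 (a - b); have := sqr_ge0 b.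
lra.
Qed.

Variables (T : finType) (mu : T -> R) (e : rel T).
Hypothesis mu_ge0 : forall v, 0 <= mu v.

Notation V := (iota 0 5).

Lemma sq1_agree g h : agree 5 g h -> sq1 g V = sq1 h V.
Proof. by move=> gh; rewrite /sq1 /= !gh. Qed.

Lemma sq2_agree g h : agree 5 g h -> sq2 g V = sq2 h V.
Proof. by move=> gh; rewrite /sq2 /= !gh. Qed.

Lemma sq3_agree g h : agree 5 g h -> sq3 g V = sq3 h V.
Proof. by move=> gh; rewrite /sq3 /= !gh. Qed.

Lemma isP3K2_agree g h : agree 5 g h -> isP3K2 g V = isP3K2 h V.
Proof. by move=> gh; rewrite /isP3K2 /= !gh. Qed.

Lemma weighted_pair (F : T -> T -> R) :
  \sum_b mu b * (\sum_c mu c * F b c) =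
  \sum_(p : T * T) mu p.1 * mu p.2 * F p.1 p.2.
Proof.
rewrite -(pair_bigA _ (fun b c => mu b * mu c * F b c)).
by apply: eq_bigr => b _; rewrite mulr_sumr; apply: eq_bigr => c _; rewrite mulrA.
Qed.

Lemma sq1_sum_ge0 : 0 <= wcount mu e (fun g => zr (sq1 g V)).
Proof.
rewrite wcount_tup5 => [|g h /sq1_agree -> //].
apply: sumr_ge0 => a _; apply: mulr_ge0 => //.
rewrite (weighted_pair (fun b c => _)) /=.
under eq_bigr => p _ do rewrite (weighted_pair (fun d f => _)) /=.
have yk p : size (flag1 (e a p.1) (e a p.2) (e p.1 p.2)) = 4.
  by case: (e _ _) (e _ _) (e _ _) => [] [] [].
exact: (bilin_sum_ge0 (Q := Q1) (fun p : T * T => mu p.1 * mu p.2) yk erefl erefl psd1).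
Qed.

(* For a fixed type (a, b, c) the sum over the two remaining vertices is the
   value of the quadratic form, and it vanishes unless the type matches. *)
Lemma sq_type_sum_ge0 (P : T -> T -> T -> bool) (y : bool -> bool -> bool -> seq Z)
    k Q :
  (forall a b c, size (y a b c) = k) -> size Q = k ->
  all (fun r => size r == k) Q -> psd k Q ->
  0 <= \sum_a mu a * \sum_b mu b * \sum_c mu c * \sum_d mu d * \sum_f mu f *
    zr (if P a b c then bilin Q (y (e a d) (e b d) (e c d))
                                (y (e a f) (e b f) (e c f)) else Z0).
Proof.
move=> yk Qk Qrow Qpsd.
apply: sumr_ge0 => a _; apply: mulr_ge0 => //.
apply: sumr_ge0 => b _; apply: mulr_ge0 => //.
apply: sumr_ge0 => c _; apply: mulr_ge0 => //.
case: (P a b c).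
  by apply: (bilin_sum_ge0 mu (y := fun d => y (e a d) (e b d) (e c d)) _ Qk Qrow).
apply: sumr_ge0 => ? _; apply: mulr_ge0 => //.
by apply: sumr_ge0 => ? _; rewrite zr0 mulr0.
Qed.

Lemma sq2_sum_ge0 : 0 <= wcount mu e (fun g => zr (sq2 g V)).
Proof.
rewrite wcount_tup5 => [|g h /sq2_agree -> //].
apply: (sq_type_sum_ge0 (fun a b c => [&& ~~ e a b, ~~ e a c & e b c])
  (y := flag2) (Q := Q2) _ erefl erefl psd2).
by move=> [] [] [].
Qed.

Lemma sq3_sum_ge0 : 0 <= wcount mu e (fun g => zr (sq3 g V)).
Proof.
rewrite wcount_tup5 => [|g h /sq3_agree -> //].
apply: (sq_type_sum_ge0 (fun a b c => [&& ~~ e a b, e a c & e b c])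
  (y := flag3) (Q := Q3) _ erefl erefl psd3).
by move=> [] [] [].
Qed.

Lemma wcount_zsum (F : rel nat -> seq nat -> Z) L :
  (forall g p, F g p = F (relpre (vtx p) g) V) ->
  (forall g h, agree 5 g h -> F g V = F h V) -> {subset L <= perms5} ->
  wcount mu e (fun g => zr (zsum (F g) L)) =
  (size L)%:R * wcount mu e (fun g => zr (F g V)).
Proof.
move=> Fpre Fext; elim: L => [|p L IH] Lsub.
  by rewrite mul0r /wcount big1 // => x _; rewrite zr0 mulr0.
rewrite /= -add1n natrD mulrDl mul1r -IH; last first.
  by move=> q qL; apply: Lsub; rewrite inE qL orbT.
rewrite -(wcount_perm mu e (P := fun g => zr (F g V)) (p := p)); last 2 first.
- by move=> g h /Fext ->.
- by apply: Lsub; rewrite mem_head.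
rewrite /wcount -big_split; apply: eq_bigr => x _ /=.
by rewrite -mulrDr zrD -Fpre.
Qed.

Lemma wcount1 : wcount mu e (fun=> 1) = (\sum_v mu v) ^+ 5.
Proof.
rewrite wcount_tup5 //.
under eq_bigr => a _.
  under eq_bigr => b _.
    under eq_bigr => c _.
      under eq_bigr => d _.
        under eq_bigr => f _ do rewrite mulr1.
        over.
      rewrite -mulr_suml; over.
    rewrite -mulr_suml; over.
  rewrite -mulr_suml; over.
by rewrite -mulr_suml; ring.
Qed.

Definition wP3K2 : R := wcount mu e (fun g => (isP3K2 g V)%:R).
Definition wbad : R := wcount mu e (fun g => (bad g V)%:R).

Lemma flag_inequality : irreflexive e -> symmetric e ->
  wbad <= 75 * ((\sum_v mu v) ^+ 5 - 108 * wP3K2).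
Proof.
move=> e_irr e_sym.
pose K := zr 2304%ZZ.
have slack_sum : wcount mu e (fun g => zr (slack g)) =
    K * (75 * (\sum_v mu v) ^+ 5 - 270 * (30 * wP3K2))
    - 2 * (15 * wcount mu e (fun g => zr (sq1 g V)))
    - 30 * wcount mu e (fun g => zr (sq2 g V))
    - 30 * wcount mu e (fun g => zr (sq3 g V)).
  have sub (a : pred (seq nat)) : {subset [seq p <- perms5 | a p] <= perms5}.
    by move=> p; rewrite mem_filter => /andP[].
  have <- : wcount mu e (fun g => zr (zsum (sq1 g) orders1)) =
            15 * wcount mu e (fun g => zr (sq1 g V)).
    by rewrite wcount_zsum //; [exact: sq1_agree | exact: sub].
  have <- : wcount mu e (fun g => zr (zsum (sq2 g) orders2)) =
            30 * wcount mu e (fun g => zr (sq2 g V)).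
    by rewrite wcount_zsum //; [exact: sq2_agree | exact: sub].
  have <- : wcount mu e (fun g => zr (zsum (sq3 g) orders3)) =
            30 * wcount mu e (fun g => zr (sq3 g V)).
    by rewrite wcount_zsum //; [exact: sq3_agree | exact: sub].
  have <- : wcount mu e (fun g => zr (zsum
      (fun p => if isP3K2 g p then Zpos xH else Z0) orders4)) = 30 * wP3K2.
    rewrite (wcount_zsum (F := fun g p => if isP3K2 g p then Zpos xH else Z0)) //.
    - have -> : size orders4 = 30 by [].
      by congr (_ * _); apply: eq_wcount => g; case: isP3K2.
    - by move=> g h /isP3K2_agree ->.
    - exact: sub.
  rewrite -wcount1 /wcount !mulr_sumr -sumrB mulr_sumr -!sumrB.
  apply: eq_bigr => x _.
  rewrite /slack /slack_on; move: (zsum _ orders1) (zsum _ orders2)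
    (zsum _ orders3) (zsum _ orders4) => s1 s2 s3 s4.
  rewrite !(zrB, zrM) -/K.
  have -> : zr 75%ZZ = 75 by rewrite !zrE; ring.
  have -> : zr 270%ZZ = 270 by rewrite !zrE; ring.
  have -> : zr 2%ZZ = 2 by rewrite !zrE; ring.
  ring.
have slack_bad : K * wbad <= wcount mu e (fun g => zr (slack g)).
  rewrite /wbad /wcount mulr_sumr; apply: ler_sum => x _.
  rewrite mulrCA ler_wpM2l ?prodr_ge0 //.
  apply: le_trans (ler_zr (slack_ge (pattern_simple _ e_irr e_sym))).
  by case: bad; rewrite ?mulr1 ?mulr0.
have K_gt0 : 0 < K by rewrite /K !zrE; lra.
have := sq1_sum_ge0; have := sq2_sum_ge0; have := sq3_sum_ge0.
move=> ? ? ?; rewrite -(ler_pM2l K_gt0); lra.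
Qed.

End FlagInequality.

(** ** Partitions from an induced 2K_2 *)

Section Reference.
Variables (R : realFieldType) (T : finType) (e : rel T).
Hypotheses (e_irr : irreflexive e) (e_sym : symmetric e).

Notation one := (fun _ : T => 1 : R).
Notation n := (#|T|%:R : R).

Definition blow (f : T -> 'I_6) : rel T := fun x y => k3k3 (f x) (f y).

Definition wrong (f : T -> 'I_6) : R :=
  \sum_x \sum_y (e x y != blow f x y)%:R.

Definition count2K2 : R :=
  \sum_a \sum_b \sum_c \sum_d (is2K2 (pattern e (nth a [:: a; b; c; d])))%:R.

Lemma wcount_one (P : rel nat -> R) :
  (forall g h, agree 5 g h -> P g = P h) ->
  wcount one e P = \sum_a \sum_b \sum_c \sum_d \sum_f
    P (pattern e (nth a [:: a; b; c; d; f])).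
Proof.
move=> Pext; rewrite wcount_tup5 //.
by do 5!(apply: eq_bigr => ? _; rewrite mul1r).
Qed.

Lemma wP3K2_le_2K2 : wP3K2 one e <= n * count2K2.
Proof.
rewrite /wP3K2 wcount_one; last by move=> g h /isP3K2_agree ->.
rewrite /count2K2 mulr_sumr; apply: ler_sum => a _.
rewrite mulr_sumr; apply: ler_sum => b _.
rewrite -sumr_const mulr_suml; apply: ler_sum => c _; rewrite mul1r.
apply: ler_sum => d _; apply: ler_sum => f _.
rewrite /isP3K2 /is2K2 /pattern /=; rewrite ler_nat.
by case: (e a b) (e b c) (e a c) (e d f) (e a d) (e a f) (e b d) (e b f) =>
  [] [] [] [] [] [] [] [] //=; rewrite ?leqnn ?leq0n ?leq_b1.
Qed.

Definition sum6 (F : T -> T -> T -> T -> T -> T -> R) : R :=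
  \sum_a \sum_b \sum_c \sum_d \sum_x \sum_y F a b c d x y.

Lemma sum6D F H : sum6 (fun a b c d x y => F a b c d x y + H a b c d x y) =
  sum6 F + sum6 H.
Proof. by rewrite /sum6; do 6!(rewrite -big_split; apply: eq_bigr => ? _). Qed.

Lemma wrong_2K2 f : (forall f', wrong f <= wrong f') ->
  wrong f * count2K2 <= 6 * n * wbad one e.
Proof.
move=> f_min.
pose bad5 a b c d f : R := (bad (pattern e (nth a [:: a; b; c; d; f])) (iota 0 5))%:R.
have -> : 6 * n * wbad one e = sum6 (fun a b c d x y =>
    bad5 b c d x y + bad5 a c d x y + bad5 a b d x y + bad5 a b c x y
     + bad5 a b c d y + bad5 a b c d x).
  have -> : wbad one e = \sum_a \sum_b \sum_c \sum_d \sum_f bad5 a b c d f.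
    by apply: wcount_one => g h /bad_agree ->.
  set S := \sum_a _; rewrite !sum6D.
  have -> : 6 * n * S = n * S + n * S + n * S + n * S + n * S + n * S by ring.
  congr (_ + _ + _ + _ + _ + _); rewrite /S /sum6.
  - by rewrite sumr_const mulr_natl.
  - by rewrite mulr_sumr; apply: eq_bigr => a _; rewrite sumr_const mulr_natl.
  - do 2!(rewrite mulr_sumr; apply: eq_bigr => ? _).
    by rewrite sumr_const mulr_natl.
  - do 3!(rewrite mulr_sumr; apply: eq_bigr => ? _).
    by rewrite sumr_const mulr_natl.
  - do 4!(rewrite mulr_sumr; apply: eq_bigr => ? _).
    by rewrite sumr_const mulr_natl.
  - do 5!(rewrite mulr_sumr; apply: eq_bigr => ? _).
    by rewrite sumr_const mulr_natl.
rewrite /count2K2 mulr_sumr; apply: ler_sum => a _.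
rewrite mulr_sumr; apply: ler_sum => b _.
rewrite mulr_sumr; apply: ler_sum => c _.
rewrite mulr_sumr; apply: ler_sum => d _.
case: (boolP (is2K2 _)) => [is2|_]; last first.
  by rewrite mulr0; do 2!apply: sumr_ge0 => ? _; rewrite !addr_ge0.
pose f' v := Ordinal (place_lt (e a v) (e b v) (e c v) (e d v)).
rewrite mulr1; apply: le_trans (f_min f') _.
apply: ler_sum => x _; apply: ler_sum => y _.
have gs := pattern_simple (nth a [:: a; b; c; d; x; y]) e_irr e_sym.
have badE i : i \in iota 0 6 ->
  (bad (pattern e (nth a [:: a; b; c; d; x; y])) (rem i (iota 0 6)))%:R <=
  bad5 b c d x y + bad5 a c d x y + bad5 a b d x y + bad5 a b c x y
     + bad5 a b c d y + bad5 a b c d x.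
  have ge0 a1 a2 a3 a4 a5 : 0 <= bad5 a1 a2 a3 a4 a5 by [].
  move: (ge0 b c d x y) (ge0 a c d x y) (ge0 a b d x y) (ge0 a b c x y)
    (ge0 a b c d y) (ge0 a b c d x).
  rewrite mem_iota => ? ? ? ? ? ? i_lt; move: i i_lt; apply: ltn6_cases.
  - rewrite -[X in X <= _]/(bad5 b c d x y); lra.
  - rewrite -[X in X <= _]/(bad5 a c d x y); lra.
  - rewrite -[X in X <= _]/(bad5 a b d x y); lra.
  - rewrite -[X in X <= _]/(bad5 a b c x y); lra.
  - rewrite -[X in X <= _]/(bad5 a b c d y); lra.
  - rewrite -[X in X <= _]/(bad5 a b c d x); lra.
case: (boolP (has (fun i => bad (pattern e (nth a [:: a; b; c; d; x; y]))
                              (rem i (iota 0 6))) (iota 0 6))) => [/hasP[i i_in bad_i]|ok].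
  by apply: le_trans (badE i i_in); rewrite bad_i ler_nat leq_b1.
have := place_adj gs is2 ok; rewrite /blow /pattern /= => ->.
by rewrite eqxx !addr_ge0.
Qed.
End Reference.

(** ** The polynomial of the blow-ups of K_3 + K_3 *)

Section Optimum.
Variable R : realFieldType.

Definition p3 (a b c : R) : R := a ^+ 2 * (b + c) + b ^+ 2 * (a + c) + c ^+ 2 * (a + b).
Definition k2 (a b c : R) : R := 2 * (a * b + a * c + b * c).
Definition hpoly (a b c d f g : R) : R :=
  p3 a b c * k2 d f g + p3 d f g * k2 a b c.

Lemma schur (a b c : R) : 0 <= a -> 0 <= b -> 0 <= c ->
  0 <= (a + b + c) ^+ 3 - 4 * (a + b + c) * (a * b + a * c + b * c)
       + 9 * (a * b * c).
Proof.
wlog le_ab : a b / a <= b.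
  move=> W a0 b0 c0; have [ab|/ltW ba] := leP a b; first exact: W.
  by have := W b a ba b0 a0 c0; congr (0 <= _); ring.
wlog le_bc : a b c le_ab / b <= c.
  move=> W a0 b0 c0; have [bc|/ltW cb] := leP b c; first exact: W.
  have [ac|/ltW ca] := leP a c.
    by have := W a c b ac cb a0 c0 b0; congr (0 <= _); ring.
  by have := W c a b ca le_ab c0 a0 b0; congr (0 <= _); ring.
move=> a0 b0 c0.
have -> : (a + b + c) ^+ 3 - 4 * (a + b + c) * (a * b + a * c + b * c)
  + 9 * (a * b * c) =
  a * ((b - a) * (c - a)) + (c - b) ^+ 2 * (b + c - a) by ring.
apply: addr_ge0; apply: mulr_ge0; rewrite ?sqr_ge0 ?mulr_ge0 ?subr_ge0 //.
  exact: le_trans le_bc.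
by rewrite (le_trans le_ab) // lerDl.
Qed.

(* Up to a factor, the variance of [a], [b], [c]; Schur's inequality bounds [p3]
   in terms of it. *)
Definition spread (a b c : R) : R := (a + b + c) ^+ 2 / 3 - (a * b + a * c + b * c).

Lemma spread_ge (a b c : R) : (a - (a + b + c) / 3) ^+ 2 <= 2 * spread a b c.
Proof.
rewrite /spread; have := sqr_ge0 (b - (a + b + c) / 3).
have := sqr_ge0 (c - (a + b + c) / 3); lra.
Qed.

Lemma p3_le (a b c : R) : 0 <= a -> 0 <= b -> 0 <= c ->
  p3 a b c <= (a + b + c) * (2 / 3 * (a + b + c) ^+ 2 + spread a b c) / 3.
Proof.
by move=> a0 b0 c0; have := schur a0 b0 c0; rewrite /p3 /spread; lra.
Qed.

Lemma two_sided (s t u v : R) : 0 <= s -> 0 <= t -> s + t = 1 ->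
  0 <= u -> 0 <= v -> u <= s ^+ 2 / 3 -> v <= t ^+ 2 / 3 ->
  s * (2 / 3 * s ^+ 2 + u) * (t ^+ 2 / 3 - v)
  + t * (2 / 3 * t ^+ 2 + v) * (s ^+ 2 / 3 - u)
  <= 1 / 72 - (1 / 3000) * ((s - t) ^+ 2 + u + v).
Proof.
wlog ts : s t u v / t <= s.
  move=> W s0 t0 st u0 v0 us vt; have [ts|/ltW st'] := leP t s; first exact: W.
  have ts1 : t + s = 1 by lra.
  have := W t s v u st' t0 s0 ts1 v0 u0 vt us; lra.
move=> s0 t0 st u0 v0 us vt.
have tE : t = 1 - s by lra.
have s12 : 1 / 2 <= s by lra.
have s1 : s <= 1 by lra.
have uv0 : 0 <= u * v by apply: mulr_ge0.
have -> : s * (2 / 3 * s ^+ 2 + u) * (t ^+ 2 / 3 - v)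
  + t * (2 / 3 * t ^+ 2 + v) * (s ^+ 2 / 3 - u) =
  2 / 9 * (s * t) ^+ 2 * (s + t) + u * (t ^+ 2 * (s - 2 * t)) / 3
  + v * (s ^+ 2 * (t - 2 * s)) / 3 - u * v * (s + t) by field.
rewrite st !mulr1.
have st4 : s * t <= 1 / 4 by have := sqr_ge0 (s - 1 / 2); rewrite tE; lra.
have st0 : 0 <= s * t by apply: mulr_ge0.
have qE : (s - t) ^+ 2 = 1 - 4 * (s * t) by rewrite tE; ring.
have cv : s ^+ 2 * (t - 2 * s) <= - (1 / 8).
  have : 1 / 4 <= s ^+ 2 by nra.
  rewrite tE => s4; have : (s ^+ 2 - 1 / 4) * (3 * s - 1) >= 0 by apply: mulr_ge0; lra.
  lra.
have {}cv := ler_wpM2l v0 cv.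
have [s35|s35] := leP s (3 / 5).
  have cu : t ^+ 2 * (s - 2 * t) <= - (4 / 125).
    have t4 : 4 / 25 <= t ^+ 2 by nra.
    have : (t ^+ 2 - 4 / 25) * (2 * t - s) >= 0 by apply: mulr_ge0; lra.
    lra.
  have {}cu := ler_wpM2l u0 cu.
  have : (s * t) ^+ 2 <= s * t / 4 by nra.
  lra.
have u3 : u <= 1 / 3 by nra.
have v3 : v <= 1 / 3 by nra.
have st25 : s * t <= 6 / 25.
  have : (s - 3 / 5) * (s - 2 / 5) >= 0 by apply: mulr_ge0; lra.
  rewrite tE; lra.
have [s23|s23] := leP s (2 / 3).
  have cu : u * (t ^+ 2 * (s - 2 * t)) <= 0.
    apply: mulr_ge0_le0 => //; apply: mulr_ge0_le0; rewrite ?sqr_ge0 //; lra.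
  have : (s * t) ^+ 2 <= (6 / 25) ^+ 2 by rewrite ler_sqr ?nnegrE //; lra.
  lra.
have cu : u * (t ^+ 2 * (s - 2 * t)) <= s ^+ 2 / 3 * (t ^+ 2 * (s - 2 * t)).
  by apply: ler_wpM2r => //; apply: mulr_ge0; rewrite ?sqr_ge0 //; lra.
have s2t : s ^+ 2 * t <= 4 / 27.
  have : (s - 2 / 3) ^+ 2 * (s + 1 / 3) >= 0 by apply: mulr_ge0; rewrite ?sqr_ge0 //; lra.
  rewrite tE; lra.
have st29 : s * t <= 2 / 9.
  have : (s - 2 / 3) * (s - 1 / 3) >= 0 by apply: mulr_ge0; lra.
  rewrite tE; lra.
have : s ^+ 2 * t * (s * t) <= 4 / 27 * (2 / 9) by rewrite ler_pM // mulr_ge0 ?sqr_ge0.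
have -> : s ^+ 2 * t * (s * t) = (s * t) ^+ 2 * (2 + (s - 2 * t)) / 3.
  by rewrite tE; field.
lra.
Qed.

Lemma hpoly_gap (a b c d f g : R) :
  0 <= a -> 0 <= b -> 0 <= c -> 0 <= d -> 0 <= f -> 0 <= g ->
  a + b + c + d + f + g = 1 ->
  (a - 1 / 6) ^+ 2 <= 120 * 150 * (1 / 108 - hpoly a b c d f g).
Proof.
move=> a0 b0 c0 d0 f0 g0 sum1.
set s := a + b + c; set t := d + f + g.
have s0 : 0 <= s by rewrite !addr_ge0. have t0 : 0 <= t by rewrite !addr_ge0.
have st : s + t = 1 by rewrite -sum1 /s /t; ring.
have u0 : 0 <= spread a b c.
  by have := spread_ge a b c; have := sqr_ge0 (a - (a + b + c) / 3); lra.
have v0 : 0 <= spread d f g.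
  by have := spread_ge d f g; have := sqr_ge0 (d - (d + f + g) / 3); lra.
have us : spread a b c <= s ^+ 2 / 3.
  by rewrite /spread -/s gerBl !addr_ge0 ?mulr_ge0.
have vt : spread d f g <= t ^+ 2 / 3.
  by rewrite /spread -/t gerBl !addr_ge0 ?mulr_ge0.
have := two_sided s0 t0 st u0 v0 us vt.
have kA : k2 a b c = 2 * (s ^+ 2 / 3 - spread a b c) by rewrite /k2 /spread -/s; ring.
have kB : k2 d f g = 2 * (t ^+ 2 / 3 - spread d f g) by rewrite /k2 /spread -/t; ring.
have pA := p3_le a0 b0 c0; have pB := p3_le d0 f0 g0.
have hA : p3 a b c * k2 d f g <= s * (2 / 3 * s ^+ 2 + spread a b c) / 3 * k2 d f g.
  by rewrite ler_wpM2r // kB mulr_ge0 ?subr_ge0.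
have hB : p3 d f g * k2 a b c <= t * (2 / 3 * t ^+ 2 + spread d f g) / 3 * k2 a b c.
  by rewrite ler_wpM2r // kA mulr_ge0 ?subr_ge0.
rewrite kA in hB; rewrite kB in hA; rewrite /hpoly kA kB.
have := spread_ge a b c; rewrite -/s.
have := sqr_ge0 ((a - s / 3) - (s - t) / 6).
have tE : t = 1 - s by rewrite -st; ring.
move: (spread a b c) (spread d f g) (p3 a b c) (p3 d f g) u0 v0 hA hB {us vt pA pB kA kB}.
move: s t s0 t0 st tE => s t s0 t0 st tE u v pa pb u0 v0 hA hB.
have -> : a - 1 / 6 = (a - s / 3) + (s - t) / 6 by rewrite tE; field.
move: (a - s / 3) => z H1 H2 H3.
have := sqr_ge0 (s - t); lra.
Qed.
End Optimum.

Definition part_check : bool :=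
  let L := iota 0 6 in
  all (fun i => all (fun j => all (fun l => all (fun p => all (fun q =>
    isP3K2 (relpre (nth 0%N [:: i; j; l; p; q]) k3k3) (iota 0 5)
    == [&& k3k3 i j, l == i, k3k3 p q & (i < 3)%N != (p < 3)%N]) L) L) L) L) L.

Lemma part_checkP : part_check.
Proof. by vm_compute. Qed.

Section BlowupCount.
Variable R : realFieldType.

Section Pushforward.
Variables (T : finType) (mu : T -> R) (f : T -> 'I_6).

Definition part_weight (i : 'I_6) : R := \sum_(v | f v == i) mu v.

Lemma sum_push (F : 'I_6 -> R) :
  \sum_v mu v * F (f v) = \sum_i part_weight i * F i.
Proof.
rewrite (partition_big f xpredT) //=; apply: eq_bigr => i _.
by rewrite /part_weight mulr_suml; apply: eq_bigr => v /eqP ->.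
Qed.

Lemma sum_part_weight : \sum_i part_weight i = \sum_v mu v.
Proof. by rewrite [RHS](partition_big f xpredT). Qed.

Definition k3k3_ord : rel 'I_6 := fun i j => k3k3 i j.

Lemma wcount_blow (P : rel nat -> R) :
  (forall g h, agree 5 g h -> P g = P h) ->
  wcount mu (blow f) P = wcount part_weight k3k3_ord P.
Proof.
move=> Pext; rewrite !wcount_tup5 //.
pose F i j k l m := P (pattern k3k3_ord (nth i [:: i; j; k; l; m])).
transitivity (\sum_a mu a * \sum_b mu b * \sum_c mu c * \sum_d mu d *
    \sum_g mu g * F (f a) (f b) (f c) (f d) (f g)).
  apply: eq_bigr => a _; congr (_ * _); apply: eq_bigr => b _; congr (_ * _).
  apply: eq_bigr => c _; congr (_ * _); apply: eq_bigr => d _; congr (_ * _).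
  apply: eq_bigr => g _; congr (_ * _); apply: Pext => i j i5 j5.
  have fE k : f (nth a [:: a; b; c; d; g] k) =
      nth (f a) [:: f a; f b; f c; f d; f g] k.
    by case: k => [|[|[|[|[|k]]]]] //=; rewrite !nth_nil.
  by rewrite /pattern /blow !fE.
rewrite (sum_push (fun i => \sum_b mu b * \sum_c mu c * \sum_d mu d *
  \sum_g mu g * F i (f b) (f c) (f d) (f g))).
apply: eq_bigr => i _; congr (_ * _).
rewrite (sum_push (fun j => \sum_c mu c * \sum_d mu d *
  \sum_g mu g * F i j (f c) (f d) (f g))).
apply: eq_bigr => j _; congr (_ * _).
rewrite (sum_push (fun k => \sum_d mu d * \sum_g mu g * F i j k (f d) (f g))).
apply: eq_bigr => k _; congr (_ * _).
rewrite (sum_push (fun l => \sum_g mu g * F i j k l (f g))).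
apply: eq_bigr => l _; congr (_ * _).
exact: sum_push.
Qed.

End Pushforward.

Notation o i := (inord i : 'I_6).

Definition hvec (a : 'I_6 -> R) : R :=
  hpoly (a (o 0)) (a (o 1)) (a (o 2)) (a (o 3)) (a (o 4)) (a (o 5)).

Lemma sum6E (F : 'I_6 -> R) :
  \sum_i F i = F (o 0) + F (o 1) + F (o 2) + F (o 3) + F (o 4) + F (o 5).
Proof.
rewrite !big_ord_recl big_ord0 addr0 !addrA.
by congr (_ + _ + _ + _ + _ + _); congr F; apply/val_inj; rewrite /= inordK.
Qed.

Lemma isP3K2_k3k3 (i j l p q : 'I_6) :
  isP3K2 (pattern k3k3_ord (nth i [:: i; j; l; p; q])) (iota 0 5) =
  [&& k3k3 i j, l == i :> nat, k3k3 p q & (i < 3)%N != (p < 3)%N].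
Proof.
have /allP/(_ i) := part_checkP; rewrite mem_iota ltn_ord => /(_ isT).
move=> /allP/(_ j); rewrite mem_iota ltn_ord => /(_ isT).
move=> /allP/(_ l); rewrite mem_iota ltn_ord => /(_ isT).
move=> /allP/(_ p); rewrite mem_iota ltn_ord => /(_ isT).
move=> /allP/(_ q); rewrite mem_iota ltn_ord => /(_ isT) /eqP <-.
by [].
Qed.

Lemma wP3K2_k3k3 (a : 'I_6 -> R) : wP3K2 a k3k3_ord = hvec a.
Proof.
rewrite /wP3K2 wcount_tup5; last by move=> g h /isP3K2_agree ->.
pose X (b : bool) := \sum_p a p * \sum_q a q * (k3k3 p q && (b != (p < 3)%N))%:R.
transitivity (\sum_i a i * \sum_j a j * (a i * X (i < 3)%N * (k3k3 i j)%:R)).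
  apply: eq_bigr => i _; congr (_ * _); apply: eq_bigr => j _; congr (_ * _).
  rewrite -mulrA /X (bigD1 i) //= [Y in _ + Y]big1 ?addr0; last first.
    move=> l /negbTE li; rewrite big1 ?mulr0 // => p _; rewrite big1 ?mulr0 // => q _.
    by rewrite isP3K2_k3k3 val_eqE li andbF mulr0.
  congr (_ * _); rewrite mulr_suml; apply: eq_bigr => p _.
  rewrite -mulrA; congr (_ * _); rewrite mulr_suml; apply: eq_bigr => q _.
  rewrite isP3K2_k3k3 eqxx /= -mulrA; congr (_ * _).
  by rewrite -natrM mulnb andbC andbA.
have X1 : X true = k2 (a (o 3)) (a (o 4)) (a (o 5)).
  by rewrite /X !sum6E /k3k3 /= !inordK //=; rewrite /k2; ring.
have X0 : X false = k2 (a (o 0)) (a (o 1)) (a (o 2)).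
  by rewrite /X !sum6E /k3k3 /= !inordK //=; rewrite /k2; ring.
rewrite !sum6E /k3k3 /= !inordK //= X0 X1 /hvec /hpoly /p3; ring.
Qed.
Lemma wP3K2_blow (T : finType) (mu : T -> R) f :
  wP3K2 mu (blow f) = hvec (part_weight mu f).
Proof.
by rewrite -wP3K2_k3k3; apply: wcount_blow => g h /isP3K2_agree ->.
Qed.
End BlowupCount.

(** ** Comparison with the blow-up *)

Section Comparison.
Variables (R : realFieldType) (T : finType).

Notation one := (fun _ : T => 1 : R).
Notation n := (#|T|%:R : R).

Lemma sum_two_coords k (i j : 'I_k.+2) (F : T -> T -> R) : i != j ->
  \sum_(x : {ffun 'I_k.+2 -> T}) F (x i) (x j) = n ^+ k * \sum_u \sum_v F u v.
Proof.
move=> ij; have ji : (j == i) = false by rewrite eq_sym (negbTE ij).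
have count u v : \sum_(x : {ffun 'I_k.+2 -> T} | (x i == u) && (x j == v)) 1 = n ^+ k.
  pose G l y : R := if l == i then (y == u)%:R else if l == j then (y == v)%:R else 1.
  transitivity (\prod_l \sum_y G l y).
    rewrite bigA_distr_bigA /= big_mkcond; apply: eq_bigr => x _.
    rewrite (bigD1 i) //= (bigD1 j) ?ji //=.
    rewrite [X in _ * (_ * X)]big1 => [|l /andP[li lj]]; last first.
      by rewrite /G (negbTE li) (negbTE lj).
    rewrite /G !eqxx ji.
    by case: (x i == u) (x j == v) => [] []; rewrite /= ?(mulr1, mul0r, mulr0).
  rewrite (bigD1 i) //= (bigD1 j) ?ji //=.
  have G1 w : \sum_y (y == w)%:R = 1 :> R.
    by rewrite (bigD1 w) //= eqxx big1 ?addr0 // => y /negbTE ->.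
  rewrite {1}/G eqxx G1 mul1r {1}/G ji eqxx G1 mul1r.
  rewrite (eq_bigr (fun=> n)); last first.
    move=> l /andP[li lj]; rewrite /G (negbTE li) (negbTE lj).
    by rewrite sumr_const.
  rewrite prodr_const; congr (_ ^+ _).
  have -> : #|[pred l | (l != i) && (l != j)]| = #|~: [set i; j]|.
    by apply: eq_card => l; rewrite !inE negb_or.
  by have := cardsC [set i; j]; rewrite cards2 ij card_ord; lia.
rewrite mulr_sumr (partition_big (fun x : {ffun _ -> T} => x i) xpredT) //=.
apply: eq_bigr => u _; rewrite mulr_sumr.
rewrite (partition_big (fun x : {ffun _ -> T} => x j) xpredT) //=.
apply: eq_bigr => v _; rewrite -(count u v) mulr_suml.
by apply: eq_bigr => x /andP[/eqP <- /eqP <-]; rewrite mul1r.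
Qed.

Variables (e b : rel T).
Hypotheses (e_irr : irreflexive e) (b_irr : irreflexive b).

Definition differ : R := \sum_x \sum_y (e x y != b x y)%:R.

Lemma pattern_differ (P : rel nat -> bool) :
  (forall g h, agree 5 g h -> P g = P h) ->
  \sum_(x : {ffun 'I_5 -> T})
     (P (pattern e (at5 x)) != P (pattern b (at5 x)))%:R <= 20 * n ^+ 3 * differ.
Proof.
move=> Pext.
have -> : 20 * n ^+ 3 * differ =
    \sum_(x : {ffun 'I_5 -> T}) \sum_(i : 'I_5) \sum_(j : 'I_5 | j != i)
      (e (x i) (x j) != b (x i) (x j))%:R.
  rewrite exchange_big /=.
  rewrite (eq_bigr (fun=> 4 * n ^+ 3 * differ)); last first.
    move=> i _; rewrite exchange_big /=.
    rewrite (eq_bigr (fun=> n ^+ 3 * differ)); last first.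
      move=> j ji; rewrite /differ.
      by rewrite -(@sum_two_coords 3 i j (fun u v => (e u v != b u v)%:R)) // eq_sym.
    rewrite sumr_const cardC1 card_ord -mulr_natl /=; ring.
  rewrite sumr_const card_ord -mulr_natl; ring.
apply: ler_sum => x _.
have [P_eq|P_neq] := eqVneq (P (pattern e (at5 x))) _.
  by do 2!apply: sumr_ge0 => ? _.
have : ~~ [forall i : 'I_5, forall j : 'I_5,
             (j != i) ==> (e (x i) (x j) == b (x i) (x j))].
  apply: contraNN P_neq => /forallP same; apply/eqP/Pext => i j i5 j5.
  rewrite /pattern /at5; have [->|ij] := eqVneq i j; first by rewrite e_irr b_irr.
  have /forallP/(_ (inord j)) := same (inord i); rewrite -val_eqE /= !inordK //.
  by rewrite eq_sym ij => /eqP.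
rewrite negb_forall => /existsP[i]; rewrite negb_forall => /existsP[j].
rewrite negb_imply => /andP[ji eb].
rewrite (bigD1 i) //= (bigD1 j) //= eb -addrA lerDl addr_ge0 //.
  by apply: sumr_ge0.
by do 2!apply: sumr_ge0 => ? _.
Qed.

Lemma count_differ (P : rel nat -> bool) :
  (forall g h, agree 5 g h -> P g = P h) ->
  `|wcount one b (fun g => (P g)%:R) - wcount one e (fun g => (P g)%:R)|
    <= 20 * n ^+ 3 * differ.
Proof.
move=> Pext; apply: le_trans (pattern_differ Pext).
rewrite /wcount -sumrB; apply: le_trans (ler_norm_sum _ _ _) _.
apply: ler_sum => x _; rewrite /weight big1 // !mul1r.
by case: (P _) (P _) => [] []; rewrite ?subrr ?normr0 // ?subr0 ?sub0r ?normrN normr1.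
Qed.

Lemma weighted_differ (mu : T -> R) (delta : R) (P : rel nat -> bool) :
  (forall g h, agree 5 g h -> P g = P h) ->
  0 <= delta -> (forall x, `|weight mu x - 1| <= delta) ->
  wcount mu b (fun g => (P g)%:R) - wcount mu e (fun g => (P g)%:R) <=
  wcount one b (fun g => (P g)%:R) - wcount one e (fun g => (P g)%:R)
  + delta * (20 * n ^+ 3 * differ).
Proof.
move=> Pext d0 mu1.
rewrite -lerBlDl; apply: le_trans (ler_wpM2l d0 (pattern_differ Pext)).
rewrite /wcount -!sumrB mulr_sumr; apply: ler_sum => x _.
have -> : weight one x = 1 by rewrite /weight big1.
rewrite !mul1r.
have := mu1 x; rewrite ler_norml => /andP[lo hi].
by case: (P _) (P _) => [] [] /=; lra.
Qed.

End Comparison.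

Section Core.
Variable R : realFieldType.
Implicit Types a : 'I_6 -> R.

Lemma hvec_scale (k : R) a : hvec (fun i => k * a i) = k ^+ 5 * hvec a.
Proof. by rewrite /hvec /hpoly /p3 /k2; ring. Qed.

Lemma hvec_gap a i : (forall j, 0 <= a j) -> \sum_j a j = 1 ->
  (a i - 1 / 6) ^+ 2 <= 120 * 150 * (1 / 108 - hvec a).
Proof.
move=> a0; rewrite sum6E /hvec => sum1.
have gap j0 j1 j2 j3 j4 j5 : a j0 + a j1 + a j2 + a j3 + a j4 + a j5 = 1 ->
    (a j0 - 1 / 6) ^+ 2 <=
    120 * 150 * (1 / 108 - hpoly (a j0) (a j1) (a j2) (a j3) (a j4) (a j5)).
  exact: hpoly_gap.
have [k k6 ->] : exists2 k, (k < 6)%N & i = inord k.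
  by exists (nat_of_ord i); rewrite ?ltn_ord // inord_val.
move: k k6; apply: ltn6_cases.
- exact: gap.
- have := gap (inord 1) (inord 0) (inord 2) (inord 3) (inord 4) (inord 5).
  rewrite /hpoly /p3 /k2; lra.
- have := gap (inord 2) (inord 0) (inord 1) (inord 3) (inord 4) (inord 5).
  rewrite /hpoly /p3 /k2; lra.
- have := gap (inord 3) (inord 4) (inord 5) (inord 0) (inord 1) (inord 2).
  rewrite /hpoly /p3 /k2; lra.
- have := gap (inord 4) (inord 3) (inord 5) (inord 0) (inord 1) (inord 2).
  rewrite /hpoly /p3 /k2; lra.
- have := gap (inord 5) (inord 3) (inord 4) (inord 0) (inord 1) (inord 2).
  rewrite /hpoly /p3 /k2; lra.
Qed.

Lemma hvec_le a : (forall j, 0 <= a j) -> \sum_j a j = 1 -> hvec a <= 1 / 108.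
Proof.
move=> a0 sum1; have := hvec_gap ord0 a0 sum1; have := sqr_ge0 (a ord0 - 1 / 6).
lra.
Qed.

Variables (T : finType) (e : rel T) (f : T -> 'I_6).
Hypotheses (e_irr : irreflexive e) (e_sym : symmetric e).
Hypothesis f_min : forall f', wrong R e f <= wrong R e f'.

Notation one := (fun _ : T => 1 : R).
Notation n := (#|T|%:R : R).
Notation W := (wrong R e f).
Notation h := (wP3K2 one).
Notation b := (blow f).
Notation Bad := (wbad one e).

Lemma blow_irr : irreflexive b.
Proof. by move=> x; rewrite /blow /k3k3 eqxx. Qed.

Lemma wrong_ge0 : 0 <= W.
Proof. by do 2!apply: sumr_ge0 => ? _. Qed.

Lemma wrong_le_bad : 0 < n -> n ^+ 5 <= 216 * h e -> W * n ^+ 3 <= 1296 * Bad.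
Proof.
move=> n0 h_big.
have W0 := wrong_ge0.
have := wrong_2K2 e_irr e_sym f_min; have := wP3K2_le_2K2 R e.
move: (wP3K2 _ _) (count2K2 _ _) (wbad _ _) h_big => hh K Bd h_big hK WK.
have WhK : W * hh <= W * (n * K) by apply: ler_wpM2l.
have WnK : n * (W * K) <= n * (6 * n * Bd) by apply: ler_wpM2l => //; apply: ltW.
have Wh : W * n ^+ 5 <= W * (216 * hh) by apply: ler_wpM2l.
have n2 : 0 < n ^+ 2 by apply: exprn_gt0.
rewrite -(ler_pM2r n2); lra.
Qed.

Lemma sum_one : \sum_(v : T) one v = n.
Proof. by rewrite sumr_const. Qed.

Lemma blow_deficit (eta : R) : 0 < n -> 0 <= eta -> eta <= 1 / 2 ->
  (1 - eta) * n ^+ 5 <= 108 * h e ->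
  n ^+ 5 * (1 / 108) - h b <= 2000 * 1000 * eta * n ^+ 5.
Proof.
move=> n0 eta0 eta2 h_big.
have n5 : 0 < n ^+ 5 by apply: exprn_gt0.
have e5 : 0 <= eta * n ^+ 5 by rewrite mulr_ge0 // ltW.
have e5' : eta * n ^+ 5 <= 1 / 2 * n ^+ 5 by rewrite ler_wpM2r // ltW.
have h216 : n ^+ 5 <= 216 * h e by lra.
have := wrong_le_bad n0 h216.
have := flag_inequality (mu := one) (fun _ => ler01) e_irr e_sym; rewrite sum_one.
have := count_differ R e_irr blow_irr isP3K2_agree.
rewrite -/(wP3K2 one e) -/(wP3K2 one b) ler_norml => /andP[+ _].
have -> : differ R e b = W by [].
move: (wP3K2 _ _) (wP3K2 _ _) h_big => hb he *.
lra.
Qed.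

Lemma parts_close (eta : R) i : 0 < n -> 0 <= eta -> eta <= 1 / 2 ->
  (1 - eta) * n ^+ 5 <= 108 * h e ->
  (part_weight one f i / n - 1 / 6) ^+ 2 <= 120 * 150 * (2000 * 1000 * eta).
Proof.
move=> n0 eta0 eta2 h_big.
have s0 j : 0 <= n^-1 * part_weight one f j.
  by rewrite mulr_ge0 ?invr_ge0 ?(ltW n0) ?sumr_ge0.
have sum1 : \sum_j n^-1 * part_weight one f j = 1.
  by rewrite -mulr_sumr sum_part_weight sum_one mulVf ?gt_eqF.
rewrite mulrC; apply: le_trans (hvec_gap i s0 sum1) _.
rewrite ler_pM2l; last by lra.
rewrite hvec_scale -wP3K2_blow.
have n5 : 0 < n ^+ 5 by apply: exprn_gt0.
have -> : 1 / 108 - n^-1 ^+ 5 * h b = (n ^+ 5 * (1 / 108) - h b) / n ^+ 5.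
  by field; rewrite gt_eqF.
by rewrite ler_pdivrMr //; apply: blow_deficit.
Qed.

Definition kappa : R := (1296 * 4 * 81 * 100)^-1.
Definition eps0 : R := kappa / 20 / 372.
Definition eta0 : R := eps0 ^+ 2 / (120 * 150 * (2000 * 1000)).

Lemma kappa_gt0 : 0 < kappa. Proof. by rewrite /kappa invr_gt0; lra. Qed.
Lemma kappa_le1 : kappa <= 1.
Proof. by rewrite /kappa invf_le1; lra. Qed.
Lemma eps0_gt0 : 0 < eps0.
Proof. by have := kappa_gt0; rewrite /eps0; lra. Qed.
Lemma eps0_le : eps0 <= 1 / 12.
Proof. by have := kappa_le1; rewrite /eps0; lra. Qed.
Lemma eta0_gt0 : 0 < eta0.
Proof.
by rewrite /eta0 divr_gt0 //; [rewrite exprn_gt0 // eps0_gt0 | lra].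
Qed.
Lemma eta0_le : eta0 <= 1 / 2.
Proof.
rewrite /eta0; have : eps0 ^+ 2 <= 1.
  by rewrite expr_le1 ?(ltW eps0_gt0) //; have := eps0_le; lra.
lra.
Qed.

(* The weights that turn [f] into a balanced partition. *)
Definition mu (v : T) : R := 1 / 6 / (part_weight one f (f v) / n).

Lemma part_near i : 0 < n -> (1 - eta0) * n ^+ 5 <= 108 * h e ->
  `|part_weight one f i / n - 1 / 6| <= eps0.
Proof.
move=> n0 h_big; have e0 := ltW eps0_gt0.
rewrite -(@ler_pXn2r _ 2) ?nnegrE ?normr_ge0 // real_normK ?num_real //.
apply: le_trans (parts_close i n0 (ltW eta0_gt0) eta0_le h_big) _.
have -> : 120 * 150 * (2000 * 1000 * eta0) = eps0 ^+ 2 by rewrite /eta0; field.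
exact: lexx.
Qed.

Lemma mu_close v : 0 < n -> (1 - eta0) * n ^+ 5 <= 108 * h e ->
  `|mu v - 1| <= 12 * eps0.
Proof.
move=> n0 h_big.
have := part_near (f v) n0 h_big.
have e0 := eps0_gt0; have e12 := eps0_le.
rewrite /mu; set r := part_weight _ _ _ / n; rewrite ler_norml => /andP[lo hi].
have r0 : 0 < r by lra.
have -> : 1 / 6 / r - 1 = (1 / 6 - r) / r by field; rewrite gt_eqF.
rewrite normrM normfV (gtr0_norm r0) ler_pdivrMr // ler_norml.
have : 1 / 12 * eps0 <= r * eps0 by rewrite ler_wpM2r ?(ltW e0) //; lra.
by move=> ?; apply/andP; split; lra.
Qed.

Lemma weight_close (x : {ffun 'I_5 -> T}) : 0 < n ->
  (1 - eta0) * n ^+ 5 <= 108 * h e -> `|weight mu x - 1| <= kappa / 20.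
Proof.
move=> n0 h_big; set t := 12 * eps0.
have t31 : 31 * t = kappa / 20 by rewrite /t /eps0; field.
have t0 : 0 <= t by rewrite /t; have := eps0_gt0; lra.
have t1 : t <= 1 by have := kappa_le1; lra.
have mu_t v : 1 - t <= mu v <= 1 + t.
  by have := mu_close v n0 h_big; rewrite -/t ler_norml => /andP[? ?];
    apply/andP; split; lra.
have lo : (1 - t) ^+ 5 <= weight mu x.
  rewrite -[5%N]card_ord -prodr_const; apply: ler_prod => i _.
  by have /andP[-> _] := mu_t (x i); lra.
have hi : weight mu x <= (1 + t) ^+ 5.
  rewrite -[5%N]card_ord -prodr_const; apply: ler_prod => i _.
  by have /andP[m1 ->] := mu_t (x i); rewrite andbT; apply: le_trans m1; lra.
have t2 : 0 <= t ^+ 2 <= t by rewrite exprn_ge0 // ler_iXnr.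
have t3 : 0 <= t ^+ 3 <= t by rewrite exprn_ge0 // ler_iXnr.
have t4 : 0 <= t ^+ 4 <= t by rewrite exprn_ge0 // ler_iXnr.
have t5 : 0 <= t ^+ 5 <= t by rewrite exprn_ge0 // ler_iXnr.
rewrite ler_norml -t31; apply/andP; split; lra.
Qed.

Lemma blow_gain : 0 < n -> (1 - eta0) * n ^+ 5 <= 108 * h e ->
  kappa * (W * n ^+ 3) <= h b - h e.
Proof.
move=> n0 h_big.
have n5 : 0 < n ^+ 5 by apply: exprn_gt0.
have k0 := kappa_gt0; have k1 := kappa_le1.
have e0 := eta0_gt0; have e2 := eta0_le.
have h216 : n ^+ 5 <= 216 * h e.
  have : eta0 * n ^+ 5 <= 1 / 2 * n ^+ 5 by rewrite ler_wpM2r // ltW.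
  lra.
have WB := wrong_le_bad n0 h216.
have close x := weight_close x n0 h_big.
have mu_ge0 v : 0 <= mu v.
  rewrite /mu !divr_ge0 ?(ltW n0) ?sumr_ge0 //; lra.
have part_mu i : part_weight mu f i = n / 6.
  have := part_near i n0 h_big; rewrite ler_norml => /andP[lo _].
  have e12 := eps0_le.
  have : 0 < part_weight one f i / n by lra.
  rewrite pmulr_lgt0 ?invr_gt0 // => s0.
  rewrite /part_weight (eq_bigr (fun v => n / (6 * part_weight one f i) * one v)).
    by rewrite -mulr_sumr -/(part_weight one f i); field; rewrite gt_eqF.
  by move=> v /eqP fv; rewrite /mu fv; field; rewrite !gt_eqF.
have flag := flag_inequality mu_ge0 e_irr e_sym.
have hb_mu : wP3K2 mu b = n ^+ 5 * (1 / 108).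
  by rewrite wP3K2_blow /hvec /hpoly /p3 /k2 !part_mu; field.
have sum_mu : \sum_v mu v = n.
  by rewrite -(sum_part_weight mu f) sum6E !part_mu; field.
have := weighted_differ e_irr blow_irr isP3K2_agree _ close.
have -> : differ R e b = W by [].
rewrite -/(wP3K2 one e) -/(wP3K2 one b) -/(wP3K2 mu e) -/(wP3K2 mu b).
have bad_mu : Bad <= 2 * wbad mu e.
  rewrite /wbad /wcount mulr_sumr; apply: ler_sum => x _.
  rewrite mulrA ler_wpM2r //.
  have -> : weight one x = 1 by rewrite /weight big1.
  by have := close x; rewrite ler_norml => /andP[? _]; lra.
have W0 : 0 <= W * n ^+ 3 by rewrite mulr_ge0 ?wrong_ge0 // exprn_ge0 // ltW.
have kE : kappa * (1296 * 4 * 81 * 100) = 1 by rewrite /kappa mulVf //; lra.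
have kW : kappa * (1296 * 4 * 81 * 100) * (W * n ^+ 3) = W * n ^+ 3 by rewrite kE mul1r.
rewrite sum_mu in flag; rewrite hb_mu => D.
have d0 : 0 <= kappa / 20 by lra.
have := D d0; lra.
Qed.

End Core.

(** ** Copies and embeddings *)

Section Isomorphism.
Implicit Types T U V : finType.

Lemma isomorphicP T U (G : sgraph T) (H : sgraph U) :
  reflect (exists2 f : {ffun T -> U}, bijective f &
             forall x y, adj H (f x) (f y) = adj G x y)
          (isomorphic G H).
Proof.
apply: (iffP existsP) => [[f /and3P[/injectiveP f_inj /eqP f_im /forallP f_adj]]|].
  exists f; last by move=> x y; have /forallP/(_ y)/eqP := f_adj x.
  apply: inj_card_bij => //.
  by rewrite -cardsT -f_im -(cardsT T) leq_imset_card.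
move=> [f f_bij f_adj]; exists f; apply/and3P; split.
- exact/injectiveP/bij_inj.
- have [g _ gK] := f_bij; apply/eqP/setP => y; rewrite inE.
  by apply/imsetP; exists (g y); rewrite ?gK ?inE.
- by apply/forallP => x; apply/forallP => y; rewrite f_adj.
Qed.

Lemma isomorphic_refl T (G : sgraph T) : isomorphic G G.
Proof.
apply/isomorphicP; exists [ffun x => x]; last by move=> x y; rewrite !ffunE.
by exists [ffun x => x] => x; rewrite !ffunE.
Qed.

Lemma isomorphic_sym T U (G : sgraph T) (H : sgraph U) :
  isomorphic G H -> isomorphic H G.
Proof.
move=> /isomorphicP[f [g fK gK] f_adj]; apply/isomorphicP.
exists [ffun y => g y]; first by exists f => x; rewrite !ffunE.
by move=> x y; rewrite !ffunE -f_adj !gK.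
Qed.

Lemma isomorphic_trans T U V (G : sgraph T) (H : sgraph U) (K : sgraph V) :
  isomorphic G H -> isomorphic H K -> isomorphic G K.
Proof.
move=> /isomorphicP[f f_bij f_adj] /isomorphicP[g g_bij g_adj].
apply/isomorphicP; exists [ffun x => g (f x)]; last first.
  by move=> x y; rewrite !ffunE g_adj f_adj.
by apply: (eq_bij (bij_comp g_bij f_bij)) => x; rewrite ffunE.
Qed.

Lemma induced_count_iso T U V (H : sgraph U) (K : sgraph V) (G : sgraph T) :
  isomorphic H K -> induced_count H G = induced_count K G.
Proof.
move=> HK; rewrite /induced_count; apply: eq_card => S; rewrite !inE.
have half U1 U2 (H1 : sgraph U1) (H2 : sgraph U2) : isomorphic H1 H2 ->
    [exists f : {ffun U2 -> T}, [&& injectiveb f, f @: [set: U2] == S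
        & [forall x, forall y, adj G (f x) (f y) == adj H2 x y]]] ->
    [exists f : {ffun U1 -> T}, [&& injectiveb f, f @: [set: U1] == S
        & [forall x, forall y, adj G (f x) (f y) == adj H1 x y]]].
  move=> /isomorphicP[g g_bij g_adj] /existsP[f].
  move=> /and3P[/injectiveP f_inj /eqP <- /forallP f_adj].
  apply/existsP; exists [ffun x => f (g x)]; apply/and3P; split.
  - apply/injectiveP => x y; rewrite !ffunE => /f_inj.
    exact: (bij_inj g_bij).
  - have [h _ hK] := g_bij; apply/eqP/setP => z; apply/imsetP/imsetP => [] [x _ ->].
      by exists (g x); rewrite ?ffunE.
    by exists (h x); rewrite ?ffunE ?hK.
  - apply/forallP => x; apply/forallP => y; rewrite !ffunE -g_adj.
    by have /forallP/(_ (g y)) := f_adj (g x).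
by apply/idP/idP; apply: half => //; apply: isomorphic_sym.
Qed.

Lemma Lambda_induced_count (R : realType) T (G : sgraph T) :
  Lambda (@gammaP3K2 R) G = (induced_count P3K2 G)%:R.
Proof.
pose P := equivalence_partition (@isomorphic 'I_5 'I_5) [set: sgraph 'I_5].
have equivR : {in [set: sgraph 'I_5] & &, equivalence_rel (@isomorphic 'I_5 'I_5)}.
  move=> G1 G2 G3 _ _ _; split=> [|G12]; first exact: isomorphic_refl.
  apply/idP/idP; apply: isomorphic_trans => //; exact: isomorphic_sym.
have partP : partition P [set: sgraph 'I_5] by exact: equivalence_partitionP.
have /and3P[_ _ /forall_inP transP] := transversalP partP.
have inB : pblock P P3K2 \in P.
  by rewrite pblock_mem // (cover_partition partP) inE.
have /cards1P[H0 H0E] := transP _ inB.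
have memE H : (H \in iso_reps 5) && isomorphic H P3K2 = (H == H0).
  rewrite -in_set1 -H0E inE pblock_equivalence_partition ?inE //; congr (_ && _).
  by apply/idP/idP; exact: isomorphic_sym.
rewrite /Lambda (bigID (fun H => isomorphic H P3K2)) /= addrC big1; last first.
  by move=> H /andP[_ /negbTE]; rewrite /gammaP3K2 => ->; rewrite mul0r.
rewrite add0r (eq_bigl _ _ memE) big_pred1_eq /gammaP3K2.
have /andP[_ isoH0] : (H0 \in iso_reps 5) && isomorphic H0 P3K2 by rewrite memE.
by rewrite isoH0 mul1r (induced_count_iso G isoH0).
Qed.

End Isomorphism.

Lemma adj_K3K3 (i j : 'I_6) : adj K3K3 i j = k3k3 i j.
Proof.
rewrite adj_sgraph_of /dunion_rel /k3k3.
case: splitP => i' ->; case: splitP => j' ->;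
  rewrite ?adj_sgraph_of /complete_rel -?val_eqE /=;
  have := ltn_ord i'; have := ltn_ord j'; lia.
Qed.

Definition p3k2 (i j : nat) : bool :=
  if (i < 3)%N then (j < 3)%N && ((i.+1 == j) || (j.+1 == i))
  else (2 < j)%N && (i != j).

Lemma adj_P3K2 (i j : 'I_5) : adj P3K2 i j = p3k2 i j.
Proof.
rewrite adj_sgraph_of /dunion_rel /p3k2.
case: splitP => i' ->; case: splitP => j' ->;
  rewrite ?adj_sgraph_of /complete_rel /path_rel -?val_eqE /= ?ltn_ord //=;
  have := ltn_ord i'; have := ltn_ord j'; lia.
Qed.

Lemma ltn5_cases (P : nat -> Prop) :
  P 0 -> P 1 -> P 2 -> P 3 -> P 4 -> forall i, (i < 5)%N -> P i.
Proof. by move=> ? ? ? ? ?; do 5?[case=> //]. Qed.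

Lemma isP3K2P (g : rel nat) : simple_rel g ->
  reflect (agree 5 g p3k2) (isP3K2 g (iota 0 5)).
Proof.
move=> [g_irr g_sym]; apply: (iffP idP) => [|gE]; last by rewrite /isP3K2 /= !gE.
rewrite /isP3K2 /= => /and5P[g01 g12 /negbTE g02 g34].
move=> /and5P[/negbTE g03 /negbTE g04 /negbTE g13 /negbTE g14].
move=> /andP[/negbTE g23 /negbTE g24] i j i5 j5.
move: i i5; apply: ltn5_cases; move: j j5; apply: ltn5_cases;
  rewrite /p3k2 /= ?g_irr // g_sym //.
Qed.

Section Embeddings.
Variables (T : finType) (G : sgraph T).

Definition embeddings : {set {ffun 'I_5 -> T}} :=
  [set x : {ffun 'I_5 -> T} | injectiveb x &&
     [forall i, forall j, adj G (x i) (x j) == adj P3K2 i j]].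

Lemma homP (x : {ffun 'I_5 -> T}) :
  [forall i, forall j, adj G (x i) (x j) == adj P3K2 i j] =
  isP3K2 (pattern (adj G) (at5 x)) (iota 0 5).
Proof.
have gs := pattern_simple (at5 x) (@adj_irr _ G) (@adj_sym _ G).
apply/forallP/(isP3K2P gs) => [hom i j i5 j5 | gE i].
  have /forallP/(_ (inord j))/eqP := hom (inord i).
  by rewrite adj_P3K2 !inordK.
apply/forallP => j; rewrite adj_P3K2 -gE ?ltn_ord //.
by rewrite /pattern /at5 !inord_val.
Qed.

(* Only the two leaves of the path have the same neighbours, so only they can
   be mapped to the same vertex. *)
Lemma card_embeddings (R : realFieldType) :
  (#|embeddings|%:R : R) =
  wP3K2 (fun=> 1) (adj G) - count2K2 R (adj G).
Proof.
have [g_irr g_sym] := (@adj_irr _ G, @adj_sym _ G).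
apply/eqP; rewrite eq_sym subr_eq; apply/eqP.
pose hom (x : {ffun 'I_5 -> T}) := isP3K2 (pattern (adj G) (at5 x)) (iota 0 5).
have injE x : hom x -> injectiveb x = (x (inord 0) != x (inord 2)).
  move=> hx; apply/injectiveP/idP => [x_inj|x02 i j xij].
    by apply/eqP => /x_inj/(congr1 val); rewrite /= !inordK.
  have := hx; rewrite /hom => /isP3K2P gE.
  have {}gE := gE (pattern_simple _ g_irr g_sym).
  have rows k : (k < 5)%N -> p3k2 i k = p3k2 j k.
    move=> k5; rewrite -!gE ?ltn_ord //.
    by rewrite /pattern /at5 !inord_val xij.
  have {rows}rows : all (fun k => p3k2 i k == p3k2 j k) (iota 0 5).
    by apply/allP => k; rewrite mem_iota => /= k5; rewrite rows.
  have i5 := ltn_ord i; have j5 := ltn_ord j.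
  apply/val_inj; move: rows x02; rewrite -(inord_val i) -(inord_val j) in xij *.
  rewrite /= !inordK //; move: (val i) i5 (val j) j5 xij {hx gE}.
  by apply: ltn5_cases; apply: ltn5_cases => //= ->; rewrite eqxx.
have -> : wP3K2 (fun=> 1) (adj G) = \sum_x (hom x)%:R :> R.
  by apply: eq_bigr => x _; rewrite /weight big1 // mul1r.
have -> : count2K2 R (adj G) = \sum_x (hom x && (x (inord 0) == x (inord 2)))%:R.
  rewrite big_tup5; apply: eq_bigr => a _; apply: eq_bigr => b _.
  rewrite [RHS](bigD1 a) //= [Y in _ = _ + Y]big1 ?addr0; last first.
    move=> c /negbTE ca; rewrite big1 // => d _; rewrite big1 // => f _.
    by rewrite !ffunE !inordK //= eq_sym ca andbF.
  apply: eq_bigr => d _; apply: eq_bigr => f _.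
  rewrite !ffunE !inordK //= eqxx andbT /hom (isP3K2_agree (pattern_tup5 _ _ _ _ _ _)).
  rewrite /is2K2 /isP3K2 /pattern /= g_irr (g_sym b a).
  by case: (adj G a b) (adj G d f) (adj G a d) (adj G a f) (adj G b d) (adj G b f)
    => [] [] [] [] [] [].
have -> : #|embeddings|%:R = \sum_x (x \in embeddings)%:R :> R.
  by rewrite -sum1_card natr_sum big_mkcond; apply: eq_bigr => x _; case: ifP.
rewrite -big_split; apply: eq_bigr => x _ /=.
rewrite inE homP -/(hom x); case: (boolP (hom x)) => [hx|_] /=.
  by rewrite andbT injE //; case: eqP; rewrite ?addr0 ?add0r.
by rewrite andbF addr0.
Qed.
End Embeddings.

Definition aut_seq (p : bool * bool) : seq nat :=
  [:: (if p.1 then 2 else 0); 1; (if p.1 then 0 else 2);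
      (if p.2 then 4 else 3); (if p.2 then 3 else 4)]%N.

Definition aut_check : bool :=
  let L := iota 0 5 in
  all (fun a => all (fun b => all (fun c => all (fun d => all (fun f =>
    let s := [:: a; b; c; d; f] in
    (uniq s && isP3K2 (relpre (nth 0%N s) p3k2) L) ==>
    (s == aut_seq (a == 2, d == 4))) L) L) L) L) L.

Lemma aut_checkP : aut_check.
Proof. by vm_compute. Qed.

Definition aut (p : bool * bool) : {ffun 'I_5 -> 'I_5} :=
  [ffun i : 'I_5 => inord (nth 0%N (aut_seq p) i)].

Lemma aut_lt p i : (nth 0 (aut_seq p) i < 5)%N.
Proof. by case: p => [] [] []; case: i => [|[|[|[|[|i]]]]] //=; rewrite nth_nil. Qed.

Lemma autE p i : aut p i = nth 0 (aut_seq p) i :> nat.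
Proof. by rewrite ffunE inordK ?aut_lt. Qed.

Lemma card_aut : #|embeddings P3K2| = 4.
Proof.
suff -> : embeddings P3K2 = aut @: setT.
  rewrite card_imset ?cardsT ?card_prod ?card_bool //.
  move=> p q /ffunP pq.
  have := congr1 val (pq (inord 0)); have := congr1 val (pq (inord 3)).
  rewrite /= !autE !inordK //=.
  by case: p q {pq} => [] [] [] [[] []].
apply/setP => s; rewrite inE homP; apply/andP/imsetP => [[s_inj s_hom]|[p _ ->]].
  exists (s (inord 0) == 2 :> nat, s (inord 3) == 4 :> nat) => //.
  have sl k : (s (inord k) < 5)%N by apply: ltn_ord.
  have /allP/(_ (s (inord 0) : nat)) := aut_checkP; rewrite mem_iota sl => /(_ isT).
  move=> /allP/(_ (s (inord 1) : nat)); rewrite mem_iota sl => /(_ isT).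
  move=> /allP/(_ (s (inord 2) : nat)); rewrite mem_iota sl => /(_ isT).
  move=> /allP/(_ (s (inord 3) : nat)); rewrite mem_iota sl => /(_ isT).
  move=> /allP/(_ (s (inord 4) : nat)); rewrite mem_iota sl => /(_ isT).
  set S := [:: _; _; _; _; _]; cbv zeta.
  have SE k : (k < 5)%N -> nth 0%N S k = s (inord k).
    by move: k; apply: ltn5_cases.
  have -> : isP3K2 (relpre (nth 0%N S) p3k2) (iota 0 5).
    rewrite -(isP3K2_agree (g := pattern (adj P3K2) (at5 s))) // => i j i5 j5.
    by rewrite /pattern /at5 /= adj_P3K2 !SE.
  have -> : uniq S.
    apply/(uniqP 0%N) => i j; rewrite !inE => i5 j5; rewrite !SE // => /val_inj.
    by move/(injectiveP _ s_inj)/(congr1 val); rewrite /= !inordK.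
  move=> /eqP SA; apply/ffunP => i; rewrite ffunE -SA SE ?ltn_ord //.
  by rewrite !inord_val.
split.
  apply/injectiveP => i j /(congr1 val) /=.
  rewrite !autE => ij; apply/val_inj => /=.
  move: (val i) (ltn_ord i) (val j) (ltn_ord j) ij.
  by apply: ltn5_cases; apply: ltn5_cases; case: p => [] [] [].
rewrite /isP3K2 /= /pattern /at5 !adj_P3K2 !autE !inordK //.
by case: p => [] [] [].
Qed.

Lemma embeddings_induced_count (T : finType) (G : sgraph T) :
  #|embeddings G| = (4 * induced_count P3K2 G)%N.
Proof.
pose im (x : {ffun 'I_5 -> T}) := x @: [set: 'I_5].
pose Ss := [set S : {set T} | [exists f : {ffun 'I_5 -> T},
      [&& injectiveb f, f @: [set: 'I_5] == S
        & [forall x, forall y, adj G (f x) (f y) == adj P3K2 x y]]]].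
rewrite -[induced_count _ _]/(#|Ss|) -sum1_card.
rewrite (partition_big im (mem Ss)) /=; last first.
  move=> x; rewrite !inE => /andP[xi xa]; apply/existsP; exists x.
  by rewrite xi xa eqxx.
rewrite mulnC -sum_nat_const; apply: eq_bigr => S; rewrite inE => /existsP[x0].
move=> /and3P[/injectiveP x0_inj /eqP x0S /forallP x0_adj].
rewrite sum1_card; transitivity #|embeddings P3K2|; last exact: card_aut.
rewrite -[RHS](card_imset _ (f := fun s : {ffun 'I_5 -> 'I_5} =>
  [ffun i => x0 (s i)])); last first.
  by move=> s t /ffunP st; apply/ffunP => i; have := st i; rewrite !ffunE => /x0_inj.
apply: eq_card => x; rewrite unfold_in; apply/andP/imsetP => [[]|[s]].
  rewrite inE => /andP[/injectiveP x_inj /forallP x_adj] /eqP xS.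
  have x_in i : x i \in x0 @: [set: 'I_5] by rewrite x0S -xS imset_f.
  have pick i : exists j, x i == x0 j.
    by have /imsetP[j _ ->] := x_in i; exists j.
  pose s := [ffun i => xchoose (pick i)].
  have sE i : x0 (s i) = x i by rewrite ffunE; apply/esym/eqP/(xchooseP (pick i)).
  exists s; last by apply/ffunP => i; rewrite ffunE sE.
  rewrite inE; apply/andP; split.
    by apply/injectiveP => i j /(congr1 x0); rewrite !sE => /x_inj.
  apply/forallP => i; apply/forallP => j; apply/eqP.
  have /forallP/(_ (s j))/eqP <- := x0_adj (s i); rewrite !sE.
  by have /forallP/(_ j)/eqP -> := x_adj i.
rewrite inE => /andP[/injectiveP s_inj /forallP s_adj] ->; split.
  rewrite inE; apply/andP; split.
    by apply/injectiveP => i j; rewrite !ffunE => /x0_inj/s_inj.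
  apply/forallP => i; apply/forallP => j; rewrite !ffunE.
  have /forallP/(_ (s j))/eqP -> := x0_adj (s i).
  by have /forallP/(_ j) := s_adj i.
rewrite -x0S; apply/eqP/setP => y; apply/imsetP/imsetP => [] [i _ ->].
  by exists (s i); rewrite ?ffunE.
exists (invF s_inj i); rewrite ?ffunE ?f_invF //.
Qed.

Lemma natr_ffact (R : nzRingType) (N k : nat) :
  ((N ^_ k)%:R : R) = \prod_(i < k) (N%:R - i%:R).
Proof.
elim: k => [|k IH]; first by rewrite big_ord0.
rewrite ffactnSr natrM big_ord_recr /= -IH.
have [kN|Nk] := leqP k N; first by rewrite natrB.
by rewrite ffact_small // !mul0r.
Qed.

Lemma natr_bin5 (R : realFieldType) (N : nat) :
  120 * ('C(N, 5)%:R : R) =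
  N%:R * (N%:R - 1) * (N%:R - 2) * (N%:R - 3) * (N%:R - 4).
Proof.
have := natr_ffact R N 5; rewrite -bin_ffact natrM mulrC => ->.
by rewrite !big_ord_recl big_ord0 /= /bump /= mulr1; ring.
Qed.

Section Counts.
Variables (R : realFieldType) (T : finType).
Notation one := (fun _ : T => 1 : R).
Notation n := (#|T|%:R : R).

(* The number of labelled copies of P_3 + K_2: [count2K2] corrects for the
   5-tuples that are not injective, see [card_embeddings]. *)
Definition score (e : rel T) : R := wP3K2 one e - count2K2 R e.

Lemma eq_score (e e' : rel T) : e =2 e' -> score e = score e'.
Proof.
move=> ee'; congr (_ - _).
  apply: eq_bigr => x _; rewrite (@isP3K2_agree _ (pattern e' (at5 x))) //.
  by move=> i j _ _; apply: ee'.
do 4!(apply: eq_bigr => ? _).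
by rewrite /is2K2 /pattern !ee'.
Qed.

Lemma wcount_2K2 (e : rel T) :
  wcount one e (fun g => (is2K2 g)%:R) = n * count2K2 R e.
Proof.
rewrite wcount_one; last by move=> g h gh; rewrite /is2K2 !gh.
rewrite /count2K2; do 4!(rewrite mulr_sumr; apply: eq_bigr => ? _).
by rewrite /is2K2 /pattern /= sumr_const mulr_natl.
Qed.

Lemma count2K2_ge0 (e : rel T) : 0 <= count2K2 R e.
Proof. by do 4!(apply: sumr_ge0 => ? _). Qed.

Lemma count2K2_le (e : rel T) : count2K2 R e <= n ^+ 4.
Proof.
apply: (@le_trans _ _ (\sum_(a : T) \sum_(b : T) \sum_(c : T) \sum_(d : T) 1)).
  by do 4!(apply: ler_sum => ? _); rewrite lern1 leq_b1.
by rewrite !sumr_const -!mulrnA -natrX ler_nat !expnS expn0 muln1 !mulnA.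
Qed.

Lemma score_le (e : rel T) : irreflexive e -> symmetric e ->
  score e <= n ^+ 5 / 108.
Proof.
move=> e_irr e_sym.
have := flag_inequality (mu := one) (fun _ => ler01) e_irr e_sym; rewrite sum_one.
have : 0 <= wbad one e.
  by apply: sumr_ge0 => x _; apply: mulr_ge0; rewrite ?prodr_ge0.
have := count2K2_ge0 e; rewrite /score; lra.
Qed.

Lemma wrong_le (e : rel T) f : wrong R e f <= n ^+ 2.
Proof.
apply: (@le_trans _ _ (\sum_(a : T) \sum_(b : T) 1)).
  by do 2!(apply: ler_sum => ? _); rewrite lern1 leq_b1.
by rewrite !sumr_const -!mulrnA -natrX ler_nat !expnS expn0 muln1.
Qed.

(* Modifying the wrong pairs gains order n^3 copies each by [blow_gain], which
   beats the possible loss from the correction term [count2K2]. *)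
Lemma score_gain (e : rel T) f : irreflexive e -> symmetric e ->
  (forall f', wrong R e f <= wrong R e f') -> 40 / kappa R <= n ->
  (1 - eta0 R) * n ^+ 5 <= 108 * wP3K2 one e ->
  kappa R / 2 * (wrong R e f * n ^+ 3) <= score (blow f) - score e.
Proof.
move=> e_irr e_sym f_min n_big h_big.
have k0 := kappa_gt0 R.
have n0 : 0 < n by apply: lt_le_trans n_big; rewrite divr_gt0 //; lra.
have gain := blow_gain e_irr e_sym f_min n0 h_big.
have ext2 g h : agree 5 g h -> is2K2 g = is2K2 h by move=> gh; rewrite /is2K2 !gh.
have := count_differ R e_irr (@blow_irr T f) ext2.
have -> : differ R e (blow f) = wrong R e f by [].
rewrite !wcount_2K2 ler_norml => /andP[_].
have W0 := wrong_ge0 R e f.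
rewrite /score; move: (count2K2 _ _) (count2K2 _ _) gain => K2 K1.
move: (wP3K2 _ _) (wP3K2 _ _) => h1 h2 gain nK.
have n3 : 0 <= n ^+ 2 by rewrite exprn_ge0 // ltW.
have K12 : K1 - K2 <= 20 * n ^+ 2 * wrong R e f.
  rewrite -(ler_pM2l n0); lra.
have : 20 <= kappa R / 2 * n.
  by move: n_big; rewrite ler_pdivrMr //; lra.
move/(ler_wpM2r (mulr_ge0 n3 W0)); lra.
Qed.

End Counts.

(** ** Perfect stability *)

Section EditDistance.
Variables (R : realType) (T : finType) (G : sgraph T).

Lemma edit_dist_le (f : T -> 'I_6) :
  edit_dist R K3K3 G <= wrong R (adj G) f / 'C(#|T|, 2)%:R.
Proof.
rewrite /edit_dist ler_wpM2r ?invr_ge0 //.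
pose F := [ffun v => f v].
pose wr := [set p : T * T | adj G p.1 p.2 != blow f p.1 p.2].
have BE x y : adj (blowup K3K3 F) x y = blow f x y.
  by rewrite adj_sgraph_of /blowup_rel !ffunE adj_K3K3.
have -> : wrong R (adj G) f = #|wr|%:R.
  rewrite /wrong pair_bigA -sum1_card natr_sum [RHS]big_mkcond /=.
  by apply: eq_bigr => p _; rewrite inE; case: (_ != _).
rewrite ler_nat.
apply: (@leq_trans #|(edges G :\: edges (blowup K3K3 F)) :|:
                     (edges (blowup K3K3 F) :\: edges G)|).
  rewrite -leEnat; exact: (bigmin_le _ F).
apply: leq_trans (leq_imset_card (fun p => [set p.1; p.2]) wr).
apply/subset_leq_card/subsetP => S; rewrite !inE.
case/orP=> /andP[notin /imsetP[p]]; rewrite inE => p_adj SE; apply/imsetP;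
  exists p => //; rewrite inE -BE.
- rewrite p_adj; apply: contraNN notin => /eqP/esym p_adj'.
  by apply/imsetP; exists p; rewrite ?inE.
- rewrite p_adj; apply: contraNN notin => /eqP p_adj'.
  by apply/imsetP; exists p; rewrite ?inE.
Qed.

End EditDistance.

Section Balanced.
Variable R : realFieldType.

Lemma hvec_mono (s t : 'I_6 -> R) : (forall i, 0 <= s i <= t i) -> hvec s <= hvec t.
Proof.
move=> st; have s0 i : 0 <= s i by have /andP[] := st i.
have le i : s i <= t i by have /andP[] := st i.
rewrite /hvec /hpoly /p3 /k2.
by do ![apply: lerD | apply: ler_pM | apply: lerXn2r];
  rewrite ?nnegrE ?addr_ge0 ?mulr_ge0 ?exprn_ge0 // ?addr_ge0 ?mulr_ge0
    ?exprn_ge0 ?(le_trans (s0 _) (le _)).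
Qed.

Lemma hvec_const (t : R) : hvec (fun=> t) = 72 * t ^+ 5.
Proof. by rewrite /hvec /hpoly /p3 /k2; ring. Qed.

Definition balanced n (v : 'I_n) : 'I_6 := inord (v %% 6).

Lemma part_balanced n i : n%:R - 5 <= 6 * part_weight (fun=> 1 : R) (@balanced n) i.
Proof.
have -> : part_weight (fun=> 1 : R) (@balanced n) i =
          #|[pred v : 'I_n | balanced v == i]|%:R.
  by rewrite /part_weight -sum1_card natr_sum.
rewrite lerBlDr -!natrM -natrD ler_nat.
have lt (q : 'I_(n %/ 6)) : (6 * q + i < n)%N.
  by have := ltn_ord q; have := ltn_ord i; lia.
have card_le : (#|[set Ordinal (lt q) | q : 'I_(n %/ 6)]| <=
                #|[pred v : 'I_n | balanced v == i]|)%N.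
  apply/subset_leq_card/subsetP => v /imsetP[q _ ->].
  have iE : ((6 * q + i) %% 6)%N = i by rewrite mulnC modnMDl modn_small.
  by rewrite inE -val_eqE /= inordK ?ltn_mod //; apply/eqP.
move: card_le; rewrite card_imset ?card_ord; last first.
  by move=> q r /(congr1 val) /= qr; apply/val_inj => /=; lia.
by move=> ?; have := divn_eq n 6; have := ltn_pmod n (isT : 0 < 6)%N; lia.
Qed.

Lemma score_balanced n : 5 <= n%:R :> R ->
  n%:R ^+ 5 / 108 - 2 * n%:R ^+ 4 <= score R (blow (@balanced n)).
Proof.
move=> n5; have := count2K2_le R (blow (@balanced n)); rewrite card_ord.
rewrite /score wP3K2_blow.
have H : hvec (fun=> (n%:R - 5) / 6) <= hvec (part_weight (fun=> 1 : R) (@balanced n)).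
  by apply: hvec_mono => i; have := @part_balanced n i => ?;
    apply/andP; split => /=; lra.
rewrite hvec_const in H; move: H; have := n5.
have -> : n%:R = (n%:R - 5) + 5 :> R by ring.
rewrite addrK; move: (n%:R - 5) => m m5.
have m0 : 0 <= m by lra.
have := exprn_ge0 2 m0; have := exprn_ge0 3 m0; have := exprn_ge0 4 m0.
move: (hvec _) (count2K2 _ _) => h k *; lra.
Qed.
End Balanced.

Section Stability.
Variables (R : realType).

Lemma Lambda_score (T : finType) (G : sgraph T) :
  Lambda (@gammaP3K2 R) G = score R (adj G) / 4.
Proof.
rewrite Lambda_induced_count /score -card_embeddings embeddings_induced_count natrM.
by field.
Qed.

Lemma lambda_score (T : finType) (G : sgraph T) :
  lambda (@gammaP3K2 R) G = score R (adj G) / 4 / 'C(#|T|, 5)%:R.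
Proof. by rewrite /lambda Lambda_score. Qed.

Lemma adj_blowup (T : finType) (f : T -> 'I_6) : adj (blowup K3K3 f) =2 blow f.
Proof. by move=> x y; rewrite adj_sgraph_of /blowup_rel adj_K3K3. Qed.

Lemma lambda_blowup (T : finType) (f : T -> 'I_6) :
  lambda (@gammaP3K2 R) (blowup K3K3 f) =
  score R (blow f) / 4 / 'C(#|T|, 5)%:R.
Proof. by rewrite lambda_score (eq_score _ (adj_blowup f)). Qed.

Lemma bin5_le N : 120 * 'C(N, 5)%:R <= N%:R ^+ 5 :> R.
Proof.
have [N4|N4] := leqP N 4.
  by rewrite bin_small ?mulr0 ?exprn_ge0.
rewrite natr_bin5; have : 5 <= N%:R :> R by rewrite ler_nat.
have -> : N%:R = (N%:R - 4) + 4 :> R by ring.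
move: (N%:R - 4) => m m4; have m0 : 0 <= m by lra.
have := exprn_ge0 2 m0; have := exprn_ge0 3 m0; have := exprn_ge0 4 m0; lra.
Qed.

Lemma bin2_ge N : 2 <= N%:R :> R -> N%:R ^+ 2 <= 4 * 'C(N, 2)%:R :> R.
Proof.
move=> N2; have := natr_ffact R N 2; rewrite -bin_ffact natrM.
rewrite !big_ord_recl big_ord0 /= /bump /= mulr1 -[2`!%:R]/(2 : R).
nra.
Qed.

Definition stability_const : R := 5 + 40 / kappa R + 432 / eta0 R.

Lemma stability_dichotomy n (G : sgraph 'I_n) : stability_const <= n%:R ->
  exists f : 'I_n -> 'I_6,
  edit_dist R K3K3 G <=
    stability_const * (lambda (@gammaP3K2 R) (blowup K3K3 f) - lambda (@gammaP3K2 R) G).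
Proof.
move=> n_big.
have k0 := kappa_gt0 R; have e0 := eta0_gt0 R.
have k1 := kappa_le1 R; have e1 := eta0_le R.
have K0 : 0 < 40 / kappa R by rewrite divr_gt0 //; lra.
have E0 : 0 < 432 / eta0 R by rewrite divr_gt0 //; lra.
have nC : 5 <= n%:R :> R /\ 40 / kappa R <= n%:R :> R /\ 432 / eta0 R <= n%:R :> R.
  by move: n_big; rewrite /stability_const => ?; split; [|split]; lra.
have [n5 [nk ne]] := nC.
have [g_irr g_sym] := (@adj_irr _ G, @adj_sym _ G).
pose f := [arg min_(f < [ffun=> ord0] : {ffun 'I_n -> 'I_6}) wrong R (adj G) f]%O.
have f_min f' : wrong R (adj G) f <= wrong R (adj G) f'.
  rewrite /f; case: arg_minP => //= g _ /(_ [ffun v => f' v] isT).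
  congr (_ <= _); apply: eq_bigr => x _; apply: eq_bigr => y _.
  by rewrite /blow !ffunE.
have c5 : 0 < 'C(n, 5)%:R :> R.
  by rewrite ltr0n bin_gt0 -(ler_nat R).
have c2 : 0 < 'C(n, 2)%:R :> R.
  by rewrite ltr0n bin_gt0 -(ler_nat R); lra.
have C5 := bin5_le n.
have C2 : n%:R ^+ 2 <= 4 * 'C(n, 2)%:R :> R by apply: bin2_ge; lra.
have n0 : 0 < n%:R :> R by lra.
have W0 := wrong_ge0 R (adj G) f.
have WC (w : R) : 0 <= w -> w / 'C(n, 2)%:R <= 4 * w / n%:R ^+ 2.
  move=> w0; rewrite ler_pdivrMr // mulrAC ler_pdivlMr ?exprn_gt0 //.
  by have := ler_wpM2l w0 C2; lra.
have editW := edit_dist_le R G f; rewrite card_ord in editW.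
have gap_ge (c : R) (b : rel 'I_n) : 0 <= c ->
   c * n%:R ^+ 3 <= score R b - score R (adj G) ->
   30 * c / n%:R ^+ 2 <= score R b / 4 / 'C(n, 5)%:R - score R (adj G) / 4 / 'C(n, 5)%:R.
  move=> c0 cb; rewrite -!mulrBl ler_pdivlMr // mulrAC ler_pdivrMr ?exprn_gt0 //.
  have := ler_wpM2l c0 C5; have := ler_wpM2r (ltW (exprn_gt0 2 n0)) cb; lra.
have const_gap (g q r : R) : 0 <= q -> 0 <= g -> q <= stability_const ->
    r <= q * g -> r <= stability_const * g.
  by move=> q0 g0 qC rq; apply: le_trans rq _; apply: ler_wpM2r.
have [h_big|h_small] := leP ((1 - eta0 R) * n%:R ^+ 5) (108 * wP3K2 (fun=> 1) (adj G)).
  exists f; rewrite lambda_blowup lambda_score !card_ord.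
  have := score_gain g_irr g_sym f_min; rewrite card_ord => /(_ nk h_big) gain.
  have c0 : 0 <= kappa R / 2 * wrong R (adj G) f by rewrite mulr_ge0 //; lra.
  rewrite mulrA in gain; have := gap_ge _ _ c0 gain.
  have q0 : 0 <= wrong R (adj G) f / n%:R ^+ 2 by rewrite divr_ge0 ?exprn_ge0 // ltW.
  have -> : 30 * (kappa R / 2 * wrong R (adj G) f) / n%:R ^+ 2 =
    15 * kappa R * (wrong R (adj G) f / n%:R ^+ 2) by field; rewrite gt_eqF.
  have := le_trans editW (WC _ W0); rewrite -mulrA.
  move: (wrong _ _ _ / _) (edit_dist _ _ _) q0 => q ed q0 ed_le gap.
  have kq : 0 <= kappa R * q by rewrite mulr_ge0 // ltW.
  apply: (const_gap _ (40 / kappa R));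
    [exact: ltW | lra | by rewrite /stability_const; lra |].
  have := ler_wpM2l (ltW K0) gap.
  have -> : 40 / kappa R * (15 * kappa R * q) = 600 * q by field; rewrite gt_eqF.
  lra.
exists (@balanced n); rewrite lambda_blowup lambda_score !card_ord.
have score_G : score R (adj G) <= wP3K2 (fun=> 1) (adj G).
  by have := count2K2_ge0 R (adj G); rewrite /score; lra.
have n4 : 0 < n%:R ^+ 4 :> R by apply: exprn_gt0.
have en : 432 * n%:R ^+ 4 <= eta0 R * n%:R ^+ 5.
  have : 432 <= eta0 R * n%:R by move: ne; rewrite ler_pdivrMr // mulrC.
  by move/(ler_wpM2r (ltW n4)); lra.
have c0 : 0 <= eta0 R / 216 * n%:R ^+ 2 by rewrite mulr_ge0 ?exprn_ge0 ?(ltW n0) //; lra.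
have gain : eta0 R / 216 * n%:R ^+ 2 * n%:R ^+ 3 <=
    score R (blow (@balanced n)) - score R (adj G).
  have := score_balanced n5; move: (score _ _) (score _ _) score_G => s1 s2; lra.
have := gap_ge _ _ c0 gain.
have -> : 30 * (eta0 R / 216 * n%:R ^+ 2) / n%:R ^+ 2 = 5 / 36 * eta0 R.
  by field; rewrite gt_eqF.
have ed4 : edit_dist R K3K3 G <= 4.
  apply: le_trans editW _; apply: le_trans (WC _ W0) _.
  rewrite ler_pdivrMr ?exprn_gt0 //; have := wrong_le R (adj G) f.
  by rewrite card_ord; lra.
move=> gap; apply: (const_gap _ (432 / eta0 R));
  [exact: ltW | lra | by rewrite /stability_const; lra |].
have := ler_wpM2l (ltW E0) gap.
have -> : 432 / eta0 R * (5 / 36 * eta0 R) = 60 by field; rewrite gt_eqF.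
lra.
Qed.
End Stability.

(** ** Limits *)

(* Imported only here: classical sets hide the notations of finite sets. *)
From mathcomp Require Import boolp classical_sets topology normedtype sequences.
Import numFieldNormedType.Exports.
Local Open Scope classical_set_scope.

Section Limits.
Variable R : realType.

Lemma cvg_inv_nat : (n%:R^-1 : R) @[n --> \oo] --> (0 : R).
Proof.
apply/gtr0_cvgV0; last exact: cvgr_idn.
by exists 1%N => // n /= n1; rewrite ltr0n.
Qed.

Lemma bin5_scale N (v : R) : 'C(N, 5)%:R * v ^+ 5 =
  1 / 120 * (N%:R * v * (N%:R * v - v) * (N%:R * v - 2 * v) * (N%:R * v - 3 * v)
    * (N%:R * v - 4 * v)).
Proof.
have -> : 'C(N, 5)%:R = 1 / 120 * (120 * 'C(N, 5)%:R) :> R by field.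
by rewrite natr_bin5; ring.
Qed.

Lemma cvg_bin5 (N : nat -> nat) : (N n)%:R * n%:R^-1 @[n --> \oo] --> (1 : R) ->
  'C(N n, 5)%:R * n%:R^-1 ^+ 5 @[n --> \oo] --> (1 / 120 : R).
Proof.
move=> N1; under eq_cvg do rewrite bin5_scale.
have v0 := cvg_inv_nat.
have Nk (k : R) : (N n)%:R * n%:R^-1 - k * n%:R^-1 @[n --> \oo] --> (1 : R).
  suff : (N n)%:R * n%:R^-1 - k * n%:R^-1 @[n --> \oo] --> (1 - k * 0 : R).
    by rewrite mulr0 subr0.
  by apply: cvgB => //; apply: cvgMr.
suff : 1 / 120 * ((N n)%:R * n%:R^-1 * ((N n)%:R * n%:R^-1 - n%:R^-1)
    * ((N n)%:R * n%:R^-1 - 2 * n%:R^-1) * ((N n)%:R * n%:R^-1 - 3 * n%:R^-1)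
    * ((N n)%:R * n%:R^-1 - 4 * n%:R^-1)) @[n --> \oo]
    --> (1 / 120 * (1 * 1 * 1 * 1 * 1) : R) by rewrite !mulr1.
apply: cvgMr; do 3![apply: cvgM; last exact: Nk]; apply: cvgM => //.
by have := Nk 1; under eq_cvg do rewrite mul1r.
Qed.

End Limits.

Section BlowupLimit.
Variable R : realType.
Notation one := (fun _ => 1 : R).

Lemma part_weight_tag (s : 'I_6 -> nat) i :
  part_weight (one : {i : 'I_6 & 'I_(s i)} -> R)
    (@tag 'I_6 (fun i => 'I_(s i))) i = (s i)%:R.
Proof.
rewrite /part_weight (eq_bigl (fun t => (tag t == i) && true)); last first.
  by move=> t; rewrite andbT.
rewrite -(sig_big_dep (fun j => j == i) (fun _ => xpredT) (fun _ _ => 1 : R)) /=.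
by rewrite big_pred1_eq sumr_const card_ord.
Qed.

Lemma lambda_blowup_sizes (s : 'I_6 -> nat) :
  lambda (@gammaP3K2 R) (blowup_sizes K3K3 s) =
  (hvec (fun i => (s i)%:R) - count2K2 R (blow (@tag 'I_6 (fun i => 'I_(s i)))))
   / 4 / 'C(#|{: {i : 'I_6 & 'I_(s i)}}|, 5)%:R.
Proof.
rewrite lambda_blowup /score wP3K2_blow; congr ((_ - _) / _ / _).
by rewrite /hvec !part_weight_tag.
Qed.

Lemma card_tag_sizes (s : 'I_6 -> nat) :
  #|{: {i : 'I_6 & 'I_(s i)}}|%:R = \sum_i (s i)%:R :> R.
Proof.
have := sum_part_weight (one : {i : 'I_6 & 'I_(s i)} -> R)
  (@tag 'I_6 (fun i => 'I_(s i))).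
by rewrite sumr_const => <-; apply: eq_bigr => i _; rewrite part_weight_tag.
Qed.

Lemma cvg_p3 (x y z : nat -> R) (a b c : R) :
  x n @[n --> \oo] --> a -> y n @[n --> \oo] --> b -> z n @[n --> \oo] --> c ->
  p3 (x n) (y n) (z n) @[n --> \oo] --> p3 a b c.
Proof.
move=> xa yb zc; rewrite /p3; apply: cvgD; first apply: cvgD.
- by apply: cvgM; [apply: cvgM | apply: cvgD].
- by apply: cvgM; [apply: cvgM | apply: cvgD].
- by apply: cvgM; [apply: cvgM | apply: cvgD].
Qed.

Lemma cvg_k2 (x y z : nat -> R) (a b c : R) :
  x n @[n --> \oo] --> a -> y n @[n --> \oo] --> b -> z n @[n --> \oo] --> c ->
  k2 (x n) (y n) (z n) @[n --> \oo] --> k2 a b c.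
Proof.
move=> xa yb zc; rewrite /k2; apply: cvgMr; apply: cvgD; first apply: cvgD.
- exact: cvgM.
- exact: cvgM.
- exact: cvgM.
Qed.

Lemma cvg_hvec (u : nat -> 'I_6 -> R) (a : 'I_6 -> R) :
  (forall i, u n i @[n --> \oo] --> a i) -> hvec (u n) @[n --> \oo] --> hvec a.
Proof.
move=> ua; rewrite /hvec /hpoly; apply: cvgD.
- by apply: cvgM; [apply: cvg_p3 | apply: cvg_k2]; exact: ua.
- by apply: cvgM; [apply: cvg_p3 | apply: cvg_k2]; exact: ua.
Qed.

Lemma cvg_sizes (s : nat -> nat) (a K : R) :
  (forall n, `|(s n)%:R - a * n%:R| <= K) -> (s n)%:R * n%:R^-1 @[n --> \oo] --> a.
Proof.
move=> sK.
suff : a + ((s n)%:R * n%:R^-1 - a) @[n --> \oo] --> (a + 0 : R).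
  by under eq_cvg do rewrite addrC subrK; rewrite addr0.
apply: cvgD; first exact: cvg_cst.
apply/norm_cvg0P.
have K0 : K * n%:R^-1 @[n --> \oo] --> (0 : R).
  suff : K * n%:R^-1 @[n --> \oo] --> (K * 0 : R) by rewrite mulr0.
  by apply: cvgMr; exact: cvg_inv_nat.
apply: squeeze_cvgr (cvg_cst 0) K0.
exists 1%N => // n /= n1; rewrite normr_ge0 /=.
have n0 : 0 < n%:R :> R by rewrite ltr0n.
have -> : (s n)%:R * n%:R^-1 - a = ((s n)%:R - a * n%:R) * n%:R^-1.
  by field; rewrite gt_eqF.
by rewrite normrM (ger0_norm (x := n%:R^-1)) ?invr_ge0 ?(ltW n0) //
   ler_wpM2r ?invr_ge0 ?(ltW n0).
Qed.

Lemma blowup_limit (a : 'rV[R]_6) : simplex a ->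
  is_blowup_lambda (@gammaP3K2 R) K3K3 a (30 * hvec (fun i => a ord0 i)).
Proof.
move=> [a_ge0 a_sum] s [K sK].
have sa i : (s n i)%:R * n%:R^-1 @[n --> \oo] --> a ord0 i.
  by apply: (@cvg_sizes (fun n => s n i) _ K) => n.
pose N n := #|{: {i : 'I_6 & 'I_(s n i)}}|.
have N1 : (N n)%:R * n%:R^-1 @[n --> \oo] --> (1 : R).
  have NE n : (N n)%:R = \sum_i (s n i)%:R :> R by exact: card_tag_sizes.
  suff : (N n)%:R * n%:R^-1 @[n --> \oo] --> (\sum_i a ord0 i : R) by rewrite a_sum.
  under eq_cvg do rewrite NE sum6E !mulrDl.
  by rewrite sum6E; do 5![apply: cvgD; last exact: sa].
pose k n := count2K2 R (blow (@tag 'I_6 (fun i => 'I_(s n i)))).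
have k0 : k n * n%:R^-1 ^+ 5 @[n --> \oo] --> (0 : R).
  pose x n : R := (N n)%:R * n%:R^-1.
  have up : x n * x n * x n * x n * n%:R^-1 @[n --> \oo] --> (0 : R).
    suff : x n * x n * x n * x n * n%:R^-1 @[n --> \oo] --> (1 * 1 * 1 * 1 * 0 : R).
      by rewrite mulr0.
    by apply: cvgM; [do 3![apply: cvgM => //] | exact: cvg_inv_nat].
  apply: squeeze_cvgr (cvg_cst 0) up.
  near=> n; rewrite mulr_ge0 ?count2K2_ge0 ?exprn_ge0 ?invr_ge0 //=.
  have -> : x n * x n * x n * x n * n%:R^-1 = (N n)%:R ^+ 4 * n%:R^-1 ^+ 5.
    by rewrite /x; ring.
  rewrite ler_wpM2r ?exprn_ge0 ?invr_ge0 //.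
  exact: count2K2_le.
have lim : (hvec (fun i => n%:R^-1 * (s n i)%:R) - k n * n%:R^-1 ^+ 5) / 4
    / ('C(N n, 5)%:R * n%:R^-1 ^+ 5) @[n --> \oo] -->
    ((hvec (fun i => a ord0 i) - 0) / 4 / (1 / 120) : R).
  apply: cvgM; last by apply: cvgV; [lra | exact: cvg_bin5].
  apply: cvgMl; apply: cvgB => //; apply: cvg_hvec => i.
  by under eq_cvg do rewrite mulrC; exact: sa.
have -> : 30 * hvec (fun i => a ord0 i) =
    (hvec (fun i => a ord0 i) - 0) / 4 / (1 / 120) :> R.
  by field.
apply: cvg_trans lim; apply: near_eq_cvg; near=> n.
have n0 : 0 < n%:R :> R by near: n; exists 1%N => // n /= n1; rewrite ltr0n.
rewrite lambda_blowup_sizes -/(N n) -/(k n) hvec_scale.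
have v0 : n%:R^-1 ^+ 5 != 0 :> R by rewrite expf_neq0 // invr_eq0 gt_eqF.
rewrite invfM.
move: (n%:R^-1 ^+ 5) v0 => v v0.
have -> : (v * hvec (fun i => (s n i)%:R) - k n * v) / 4 *
    (('C(N n, 5)%:R)^-1 / v) = (hvec (fun i => (s n i)%:R) - k n) / 4 *
    ('C(N n, 5)%:R)^-1 * (v / v) by move: (v^-1) ('C(_, _)%:R^-1) => x y; ring.
by rewrite divff // !mulr1.
Unshelve. all: by end_near.
Qed.

Lemma blowup_lambdaE (a : 'rV[R]_6) : simplex a ->
  blowup_lambda (@gammaP3K2 R) K3K3 a = 30 * hvec (fun i => a ord0 i).
Proof.
move=> a_simplex; have [a_ge0 _] := a_simplex.
apply: xget_unique; first exact: blowup_limit.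
move=> l l_lim; pose s n i := Num.trunc (a ord0 i * n%:R).
have s_close : exists K : R, forall n i, `|(s n i)%:R - a ord0 i * n%:R| <= K.
  exists 1 => n i.
  have := @trunc_itv R (a ord0 i * n%:R) (mulr_ge0 (a_ge0 i) (ler0n _ _)).
  by move=> /andP[lo]; rewrite -natr1 -/(s n i) ler_norml => hi; apply/andP; split; lra.
have lim1 := l_lim s s_close; have lim2 := blowup_limit a_simplex s_close.
exact: (norm_cvg_unique lim1 lim2).
Qed.

End BlowupLimit.

Section Maximum.
Variable R : realType.
Notation lam := (lambda (@gammaP3K2 R)).
Notation lmax := (lambda_max no_forbidden (@gammaP3K2 R)).

Lemma lambda_le n (G : sgraph 'I_n) : lam G <= n%:R ^+ 5 / 108 / 4 / 'C(n, 5)%:R.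
Proof.
rewrite lambda_score card_ord ler_wpM2r ?invr_ge0 // ler_pM2r ?invr_gt0; last lra.
by have := score_le R (@adj_irr _ G) (@adj_sym _ G); rewrite card_ord.
Qed.

Lemma lambda_le_max n (G : sgraph 'I_n) : lam G <= lmax n.
Proof.
apply: ub_le_sup; last by exists G.
by exists (n%:R ^+ 5 / 108 / 4 / 'C(n, 5)%:R) => _ [H _ <-]; apply: lambda_le.
Qed.

Lemma lambda_max_le n : lmax n <= n%:R ^+ 5 / 108 / 4 / 'C(n, 5)%:R.
Proof.
apply: ge_sup => [|_ [H _ <-]]; last exact: lambda_le.
by exists (lam (blowup K3K3 (@balanced n))), (blowup K3K3 (@balanced n)).
Qed.

Lemma lambda_max_ge n : 5 <= n%:R :> R ->
  (n%:R ^+ 5 / 108 - 2 * n%:R ^+ 4) / 4 / 'C(n, 5)%:R <= lmax n.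
Proof.
move=> n5; apply: le_trans (lambda_le_max (blowup K3K3 (@balanced n))).
rewrite lambda_blowup card_ord ler_wpM2r ?invr_ge0 // ler_pM2r ?invr_gt0; last lra.
exact: score_balanced.
Qed.

Lemma P3K2_perfectly_stable : perfectly_stable no_forbidden (@gammaP3K2 R) K3K3.
Proof.
have C0 : 0 < stability_const R.
  have := divr_gt0 (ltr0Sn R 39) (kappa_gt0 R).
  have := divr_gt0 (ltr0Sn R 431) (eta0_gt0 R).
  by rewrite /stability_const; lra.
exists (stability_const R) => // n G n_big _; have [f ed] := stability_dichotomy G n_big.
apply: le_trans ed _; rewrite ler_pM2l // lerD2r; exact: lambda_le_max.
Qed.

Lemma cvg_lambda_max : lmax n @[n --> \oo] --> (5 / 18 : R).
Proof.
have N1 : n%:R * n%:R^-1 @[n --> \oo] --> (1 : R).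
  apply: cvg_near_cst; near=> n.
  by rewrite divff // pnatr_eq0 -lt0n; near: n; exists 1%N.
have c5 : ('C(n, 5)%:R * n%:R^-1 ^+ 5)^-1 @[n --> \oo] --> ((1 / 120)^-1 : R).
  apply: cvgV; last exact: (cvg_bin5 N1).
  by rewrite gt_eqF // divr_gt0.
have up : 1 / 432 * ('C(n, 5)%:R * n%:R^-1 ^+ 5)^-1 @[n --> \oo] --> (5 / 18 : R).
  have -> : 5 / 18 = 1 / 432 * (1 / 120)^-1 :> R by field.
  exact: cvgMr.
have lo : (1 / 108 - 2 * n%:R^-1) / 4 * ('C(n, 5)%:R * n%:R^-1 ^+ 5)^-1
    @[n --> \oo] --> (5 / 18 : R).
  have -> : 5 / 18 = (1 / 108 - 2 * 0) / 4 * (1 / 120)^-1 :> R by field.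
  apply: cvgM c5; apply: cvgMl; apply: cvgB; first exact: cvg_cst.
  by apply: cvgMr; exact: cvg_inv_nat.
apply: squeeze_cvgr lo up; near=> n.
have n5 : 5 <= n%:R :> R by rewrite ler_nat; near: n; exists 5%N.
have n0 : n%:R != 0 :> R by rewrite gt_eqF //; lra.
have nE : n%:R^-1 ^+ 5 = (n%:R ^+ 5)^-1 :> R by rewrite exprVn.
rewrite invfM nE invrK; apply/andP; split.
  apply: le_trans (lambda_max_ge n5); rewrite le_eqVlt; apply/orP; left; apply/eqP.
  rewrite mulrCA [RHS]mulrC; congr (_ * _); field.
  exact: n0.
apply: le_trans (lambda_max_le n) _; rewrite le_eqVlt; apply/orP; left; apply/eqP.
by rewrite mulrCA [LHS]mulrC; congr (_ * _); field.
Unshelve. all: by end_near.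
Qed.

Lemma P3K2_maximiser (a : 'rV[R]_6) :
  blowup_maximiser (@gammaP3K2 R) K3K3 a <-> a = const_mx (1 / 6).
Proof.
have c_simplex : simplex (const_mx (1 / 6) : 'rV[R]_6).
  split=> [i|]; first by rewrite mxE; lra.
  by rewrite sum6E !mxE; field.
have hc : hvec (fun i => (const_mx (1 / 6) : 'rV[R]_6) ord0 i) = 1 / 108.
  by rewrite /hvec !mxE /hpoly /p3 /k2; field.
split=> [[a_simplex a_max]|->].
  have [a0 a1] := a_simplex.
  have := a_max _ c_simplex; rewrite !blowup_lambdaE // hc => h_ge.
  apply/rowP => i; rewrite mxE; apply/eqP; rewrite -subr_eq0 -sqrf_eq0.
  rewrite eq_le sqr_ge0 andbT.
  have := @hvec_gap R (fun i => a ord0 i) i a0 a1; lra.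
split=> // b b_simplex; have [b0 b1] := b_simplex.
rewrite !blowup_lambdaE // hc.
by have := @hvec_le R (fun i => b ord0 i) b0 b1; lra.
Qed.

End Maximum.

Theorem theorem1p8 (R : realType) :
  [/\ perfectly_stable no_forbidden (@gammaP3K2 R) K3K3,
      lambda_max no_forbidden (@gammaP3K2 R) n @[n --> \oo] --> (5 / 18 : R),
      (forall a : 'rV[R]_6, simplex a ->
         is_blowup_lambda (@gammaP3K2 R) K3K3 a
           (blowup_lambda (@gammaP3K2 R) K3K3 a))
    & forall a : 'rV[R]_6,
        blowup_maximiser (@gammaP3K2 R) K3K3 a <-> a = const_mx (1 / 6)].
Proof.
split; [exact: P3K2_perfectly_stable | exact: cvg_lambda_max | | exact: P3K2_maximiser].
by move=> a a_simplex; rewrite blowup_lambdaE //; apply: blowup_limit.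
Qed.
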